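(* There is an absolute constant $C>0$ such that for every $T$ that is a power of $2$, every $D\ge1$ and every $N$ there is a procedure that, given as input algorithms $\mathcal{A}_{\mathrm{base}},\mathcal{A}_0,\dots,\mathcal{A}_{\log_2 T}$ for the $N$-experts $D$-switching cost problem with horizon $T$, combines them into a single algorithm $\mathcal{A}$ for this problem such that: 1. for every $u\in\{0,\dots,\log_2T\}$ and every time interval $I\subseteq\{1,\dots,T\}$ with $\frac{T}{2^{u+1}}\le|I|\le\frac{T}{2^u}$, the regret of $\mathcal{A}$ w.r.t. $\mathcal{A}_u$ on $I$ is at most $C\,D\sqrt{|I|\log T}$; 2. the regret of $\mathcal{A}$ w.r.t. $\mathcal{A}_{\mathrm{base}}$ (on $\{1,\dots,T\}$) is at most $D$. Furthermore, at each round the procedure is given as input the loss of each of the input algorithms in that round and an indication of which of them made switches; the procedure then specifies one of the input algorithms, and $\mathcal{A}$ chooses the action of that algorithm. The computational overhead of the procedure is $O(\log T)$ per round (in particular, if the input algorithms are efficient then so is $\mathcal{A}$).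
   Context: $N$-experts $D$-switching cost problem: there are $T$ time steps, $T$ known in advance. At time $t=1,\dots,T$ the (possibly randomized) online algorithm chooses an expert $i_t\in\{1,\dots,N\}$, based only on $l_1,\dots,l_{t-1}$ and its own randomness; then the loss vector $l_t\in[0,1]^N$ is revealed. The algorithm pays $l_t(i_t)$, plus a switching cost $D$ if $t\ge 2$ and $i_t\neq i_{t-1}$. The adversary is oblivious: the loss sequence is fixed before the first step. The expected cost of an algorithm on a time interval $I=\{t_0+1,\dots,t_0+k\}$ (consecutive steps) is $\mathbb{E}\big[\sum_{t\in I}l_t(i_t)+D\sum_{t\in I\setminus\{t_0+1\}}1[i_t\ne i_{t-1}]\big]$. The regret of $\mathcal{A}$ w.r.t. another algorithm $\mathcal{A}'$ on $I$ is the maximum over loss sequences of the expected cost of $\mathcal{A}$ on $I$ minus the expected cost of $\mathcal{A}'$ on $I$. Computation model: arithmetic operations, exponentiation, evaluating the error function, and sampling uniformly from $[0,1]$ each cost $O(1)$. *)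

(* Defs.v *)
From HB Require Import structures.
From mathcomp Require Import all_boot all_order all_algebra.
From mathcomp Require Import all_classical all_reals all_analysis.

Set Implicit Arguments.
Unset Strict Implicit.
Unset Printing Implicit Defensive.

Import Order.TTheory GRing.Theory Num.Theory.
Local Open Scope classical_set_scope.
Local Open Scope ring_scope.

(** * The N-experts problem with switching costs

    Time steps are numbered from 0: the steps of a problem with horizon [T]
    are 0, ..., T - 1. *)

Section experts.
Context {R : realType} {N : nat}.

Definition loss := 'I_N -> R.

Definition legal_loss (x : loss) : Prop := forall i, 0 <= x i <= 1.

(* A history is the list of the loss vectors revealed so far, oldest first. *)
Definition legal_history (h : seq loss) : Prop :=
  forall t, (t < size h)%N -> legal_loss (nth (fun=> 0) h t).

(* A randomized algorithm whose randomness is the sample point of [Omega]: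
   [act h w] is the expert chosen at time [size h]. *)
Record algorithm (T : nat) d (Omega : measurableType d) := Algorithm {
  act :> seq loss -> Omega -> 'I_N;
  measurable_act : forall h, (size h < T)%N -> legal_history h ->
    forall i, measurable [set w | act h w = i] }.

Section costs.
Variables (T : nat) (D : R) (d : measure_display) (Omega : measurableType d).
Implicit Types (A : algorithm T Omega) (l : nat -> loss).

Definition action A l (t : nat) (w : Omega) : 'I_N := A (mkseq l t) w.

(* The interval is t0, ..., t0 + k - 1; a switch into its first step is free. *)
Definition interval_cost A l (t0 k : nat) (w : Omega) : R :=
  \sum_(t0 <= t < t0 + k) l t (action A l t w) +
  D * \sum_(t0.+1 <= t < t0 + k) (action A l t w != action A l t.-1 w)%:R.

Definition expected_cost (P : probability Omega R) A l (t0 k : nat) : \bar R :=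
  (\int[P]_w (interval_cost A l t0 k w)%:E)%E.

End costs.

(* The regret of [A] w.r.t. [A'] on t0, ..., t0 + k - 1. *)
Definition regret (T : nat) (D : R) d (Omega : measurableType d)
    (P : probability Omega R) (A : algorithm T Omega)
    d' (Omega' : measurableType d') (P' : probability Omega' R)
    (A' : algorithm T Omega') (t0 k : nat) : \bar R :=
  ereal_sup [set (expected_cost D P A l t0 k - expected_cost D P' A' l t0 k)%E
            | l in [set l : nat -> loss | forall t, legal_loss (l t)]].

End experts.
Arguments loss : clear implicits.
Arguments algorithm : clear implicits.
Arguments algorithm R N T {d} Omega.

(** * Computation model

    A real RAM: one memory of natural numbers (counters, addresses), one memory
    of real numbers, indirect addressing, and three-address instructions, each
    of unit cost. Reals cannot be rounded or converted to natural numbers. *)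

(* [At k] designates the cell whose address is stored in natural cell [k]. *)
Inductive addr := Cell of nat | At of nat.

(* [Pow] is the real power x ^ y for x >= 0. As usual in MathComp x / 0 = 0. *)
Inductive binop := Add | Sub | Mul | Div | Pow.
Inductive unop := Exp | Erf.

Inductive instr :=
| NConst of addr & nat
| NAdd of addr & addr & addr
| NSub of addr & addr & addr
| ROfNat of addr & addr
| ROp2 of binop & addr & addr & addr
| ROp1 of unop & addr & addr
| Sample of addr
| ReadLoss of addr & addr
| ReadSwitch of addr & addr.

Inductive test := NLe of addr & addr | RLe of addr & addr.

Inductive cmd :=
| Skip
| Do of instr
| Seq of cmd & cmd
| If of test & cmd & cmd
| While of test & cmd.

(* [prog_init] is run before the first time step, [prog_round] after each one;
   the memory persists between runs. *)
Record program := Program { prog_init : cmd; prog_round : cmd }.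

Section machine.
Context {R : realType}.

Definition erf (x : R) : R :=
  let mu := @lebesgue_measure R in
  2 / Num.sqrt pi * (Rintegral mu `[0, x] (fun t => expR (- t ^+ 2)) -
                     Rintegral mu `[x, 0] (fun t => expR (- t ^+ 2))).

(* [drawn] counts the samples used so far. *)
Record store := Store { nmem : nat -> nat; rmem : nat -> R; drawn : nat }.

(* The input algorithms are numbered 0, ..., L + 1: number 0 is A_base and
   number u + 1 is A_u. *)
Definition feedback (L : nat) := 'I_L.+2 -> R * bool.

Definition legal_feedback L (f : feedback L) : Prop :=
  forall a, 0 <= (f a).1 <= 1.

Definition legal_tape (tape : nat -> R) : Prop := forall k, 0 <= tape k <= 1.

Section semantics.
Variables (L : nat) (tape : nat -> R) (f : feedback L).

Definition loc (s : store) (a : addr) : nat :=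
  match a with Cell k => k | At k => nmem s k end.

Definition nget s a : nat := nmem s (loc s a).
Definition rget s a : R := rmem s (loc s a).

Definition nset s a (n : nat) : store :=
  Store [eta nmem s with loc s a |-> n] (rmem s) (drawn s).
Definition rset s a (x : R) : store :=
  Store (nmem s) [eta rmem s with loc s a |-> x] (drawn s).

Definition eval_binop (o : binop) (x y : R) : R :=
  match o with
  | Add => x + y | Sub => x - y | Mul => x * y | Div => x / y
  | Pow => x `^ y
  end.

Definition eval_unop (o : unop) (x : R) : R :=
  match o with Exp => expR x | Erf => erf x end.

Definition exec_instr (i : instr) (s : store) : store :=
  match i with
  | NConst a n => nset s a n
  | NAdd a b c => nset s a (nget s b + nget s c)
  | NSub a b c => nset s a (nget s b - nget s c)
  | ROfNat a b => rset s a (nget s b)%:R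
  | ROp2 o a b c => rset s a (eval_binop o (rget s b) (rget s c))
  | ROp1 o a b => rset s a (eval_unop o (rget s b))
  | Sample a =>
      let s' := rset s a (tape (drawn s)) in
      Store (nmem s') (rmem s') (drawn s).+1
  | ReadLoss a b => rset s a (f (inord (nget s b))).1
  | ReadSwitch a b => nset s a (f (inord (nget s b))).2
  end.

Definition eval_test (b : test) (s : store) : bool :=
  match b with
  | NLe a b => (nget s a <= nget s b)%N
  | RLe a b => rget s a <= rget s b
  end.

(* One computation step on a stack of pending commands. *)
Definition step (c : seq cmd * store) : seq cmd * store :=
  let: (stack, s) := c in
  if stack is c0 :: k then
    match c0 with
    | Skip => (k, s)
    | Do i => (k, exec_instr i s)
    | Seq c1 c2 => (c1 :: c2 :: k, s)
    | If b c1 c2 => ((if eval_test b s then c1 else c2) :: k, s)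
    | While b c1 => (if eval_test b s then c1 :: c0 :: k else k, s)
    end
  else (stack, s).

(* [None] when [c] does not terminate within [budget] steps. *)
Definition exec (budget : nat) (c : cmd) (s : store) : option store :=
  let: (stack, s') := iter budget step ([:: c], s) in
  if stack is [::] then Some s' else None.

End semantics.

Definition initial_store (T N L : nat) (D : R) : store :=
  Store (fun k => nth 0%N [:: 0; T; N; L]%N k) (fun k => nth 0 [:: D] k) 0.

(* The index of the input algorithm to be followed at time [size fs], read from
   natural cell 0, where [fs] lists the feedbacks on the earlier time steps.
   It is [None] when some run exceeds [budget] or the final index is illegal. *)
Definition selection (p : program) (budget T N L : nat) (D : R)
    (tape : nat -> R) (fs : seq (feedback L)) : option 'I_L.+2 :=
  let s0 := exec tape ((fun=> (0, false)) : feedback L) budget (prog_init p)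
              (initial_store T N L D) in
  let s := foldl (fun os f => obind (exec tape f budget (prog_round p)) os)
             s0 fs in
  obind (fun s => insub (nmem s 0)) s.

End machine.
Arguments feedback : clear implicits.

(** * Combining algorithms with a procedure *)

(* Independent uniform samples from [0,1]. *)
Definition uniform_source (R : realType) d (Omega : measurableType d)
    (Q : probability Omega R) (U : nat -> Omega -> R) : Prop :=
  [/\ forall k, measurable_fun setT (U k),
      forall w, legal_tape (U ^~ w) &
      forall (n : nat) (B : 'I_n -> set R), (forall k, measurable (B k)) ->
        Q [set w | forall k : 'I_n, B k (U k w)] =
        (\prod_(k < n) lebesgue_measure (B k `&` `[0%R, 1%R]))%E].

Section combination.
Context {R : realType} {N T L : nat} {d : measure_display}
  {Omega : measurableType d}.
Variables (Abase : algorithm R N T Omega)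
  (A_ : 'I_L.+1 -> algorithm R N T Omega).

(* All input algorithms run on the same sample space, so that their joint law
   is arbitrary. *)
Definition input_algorithm (a : 'I_L.+2) : algorithm R N T Omega :=
  if unlift ord0 a is Some u then A_ u else Abase.

(* Losses and switches of the input algorithms at time [t], when the losses
   revealed so far are [h] and t < size h; there is no switch at time 0. *)
Definition feedback_at (h : seq (loss R N)) (w : Omega) (t : nat) :
    feedback R L := fun a =>
  let i s := input_algorithm a (take s h) w in
  (nth (fun=> 0) h t (i t), (0 < t)%N && (i t != i t.-1)).

Definition feedbacks (h : seq (loss R N)) (w : Omega) : seq (feedback R L) :=
  mkseq (feedback_at h w) (size h).

(* [A] plays, at each time step, the action of the input algorithm selected by
   the procedure, whose samples [U] are independent of the input algorithms. *)
Definition combined_by (p : program) (budget : nat) (D : R)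
    d' (Omega' : measurableType d') (U : nat -> Omega' -> R)
    (A : algorithm R N T (Omega * Omega')%type) : Prop :=
  forall h w, (size h < T)%N -> legal_history h ->
    exists2 a, selection p budget T N D (U ^~ w.2) (feedbacks h w.1) = Some a
             & A h w = input_algorithm a h w.1.

End combination.

(* Main.v *)
(* Measure costs in units of D and let m be the cost of the algorithm combining
   A_base, A_0, ..., A_(j-1) (as expected given the inputs).  Level j plays A_j
   instead with probability w, where w is multiplied in each round by
   exp (eta_j e - 64 eta_j^2), e being the advantage m - cost of A_j, and is kept
   in [g, 1]; here eta_j = sqrt (2^j log T / T) and g = exp (-5 log T).
   Comparing one uniform threshold, drawn once, with w makes the probability of a
   switch |w' - w|.  The potential w / eta_j shows that level j loses at most
   g / eta_j per round plus the variation of w / eta_j, while the potential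
   (w - ln w) / eta_j bounds the regret to A_j on an interval of length k by
   O (log T / eta_j + k eta_j).  Both add up over the levels because 1 / eta_j
   decreases geometrically.  Levels with eta_j > 1/64, for which D sqrt (|I| log T)
   exceeds the cost of any algorithm, are dropped. *)
Require Import Defs.
From HB Require Import structures.
From mathcomp Require Import all_boot all_order all_algebra.
From mathcomp Require Import all_classical all_reals all_analysis.
From mathcomp Require Import measurable_realfun ring lra zify.

Set Implicit Arguments.
Unset Strict Implicit.
Unset Printing Implicit Defensive.

Import Order.TTheory GRing.Theory Num.Theory.
Local Open Scope classical_set_scope.
Local Open Scope ring_scope.

(** * Updating the weight of one level *)

Section one_level.
Context {R : realType}.
Implicit Types (g eta w e s y : R).

(** The weights are driven by [mix], never by the cost actually paid, so they are functions of the
    inputs alone. This is what lets one threshold per level serve all rounds: given the inputs,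
    every weight path is deterministic, and the thresholds of different levels stay independent. A
    level's own expected switching must then be part of the cost that it passes upwards; the drift
    [64 * eta ^+ 2] absorbs this charge. The feedback reports a switch of [A_u] into the first step
    of an interval, which the regret does not charge to [A_u]; this loses one [D]. For [A_base] the
    interval starts at time 0 and nothing is lost, but all levels together may cost only one unit:
    hence the start of every weight at the floor, and the size of that floor. In the code [log T] is
    [L], the binary logarithm, in both the rates and the floor. For [L = 0] the rates vanish and the
    floor is 1, so this horizon is treated apart. *)

Lemma expR_le_quadratic s : s <= 1 / 2 -> expR s <= 1 + s + 2 * s ^+ 2.
Proof.
move=> s_le; have E0 := expR_gt0 s.
have : expR s * (1 - s) <= 1.
  rewrite -[leRHS](expR0 R) -(subrr s) expRD ler_pM2l //.
  exact: expR_ge1Dx.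
rewrite expr2; nra.
Qed.

Lemma ln_le_subr1 y : 0 < y -> ln y <= y - 1.
Proof. by move=> y0; have := expR_ge1Dx (ln y); rewrite lnK ?posrE //; lra. Qed.

Definition clip g y : R := if 1 <= y then 1 else if y <= g then g else y.

Lemma clip_ge g y : g <= 1 -> g <= clip g y.
Proof.
by move=> g1; rewrite /clip; case: (leP 1 y) => // ?; case: (leP y g) => ?; lra.
Qed.

Lemma clip_le1 g y : g <= 1 -> clip g y <= 1.
Proof.
by move=> g1; rewrite /clip; case: (leP 1 y) => // ?; case: (leP y g) => ?; lra.
Qed.

(** Only the lower clip raises [y], by less than [g]; this is the origin of the loss [g / eta] per
    round. *)
Lemma clip_leD g y : 0 < g -> 0 < y -> clip g y <= y + g.
Proof.
by rewrite /clip => ? ?; case: (leP 1 y) => ?; [|case: (leP y g) => ?]; lra.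
Qed.

(** Clipping is the projection onto [[g, 1]], an interval that contains [w]. *)
Lemma clip_dist g y w : g <= w -> w <= 1 -> `|clip g y - w| <= `|y - w|.
Proof.
rewrite /clip => ? ?; case: (leP 1 y) => ?; first by rewrite !ger0_norm; lra.
by case: (leP y g) => ? //; rewrite !ler0_norm; lra.
Qed.

Definition challenger_potential w : R := w - ln w.

(** The function [w - ln w] is convex with its minimum at 1, and clipping moves [y] towards 1 on
    either side. *)
Lemma challenger_potential_clip g y : 0 < g -> g <= 1 -> 0 < y ->
  challenger_potential (clip g y) <= challenger_potential y.
Proof.
rewrite /challenger_potential /clip => g0 g1 y0.
case: (leP 1 y) => ?; first by have := ln_le_subr1 y0; rewrite ln1; lra.
case: (leP y g) => // ?.
have : ln (y / g) <= y / g - 1 by rewrite ln_le_subr1 // divr_gt0.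
rewrite ln_div ?posrE //.
have : y / g - 1 <= y - g.
  have -> : y / g - 1 = (y - g) / g by field; rewrite gt_eqF.
  by rewrite ler_pdivrMr //; nra.
lra.
Qed.

Definition upd g eta w e : R := clip g (w * expR (eta * e - 64 * eta ^+ 2)).

Section step.
Variables (g eta w e : R).
Hypotheses (g_gt0 : 0 < g) (g_le_w : g <= w) (w_le1 : w <= 1).
Hypotheses (eta_gt0 : 0 < eta) (eta_le : eta <= 1 / 64) (e_le3 : `|e| <= 3).

(** The gap contributes at most [3 * eta], and the drift at most [eta] because [eta <= 1 / 64]. *)
Let exponent_bounds s : s = eta * e - 64 * eta ^+ 2 ->
  [/\ `|s| <= 4 * eta, 0 <= s ^+ 2 <= 16 * eta ^+ 2 &
      w * (1 + s) <= w * expR s <= w * (1 + s + 2 * s ^+ 2)].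
Proof.
move: g_gt0 g_le_w eta_gt0 eta_le e_le3 => g0 gw eta0 eta1 e3 ->.
have w0 : 0 < w by lra.
have s_le : `|eta * e - 64 * eta ^+ 2| <= 4 * eta.
  move: e3; rewrite !ler_norml expr2 => /andP[? ?].
  by apply/andP; split; nra.
split=> //.
  rewrite sqr_ge0 -real_normK ?num_real //.
  have -> : 16 * eta ^+ 2 = (4 * eta) ^+ 2 by ring.
  by rewrite ler_sqr ?nnegrE //; lra.
rewrite !ler_pM2l ?expR_ge1Dx //=; apply: expR_le_quadratic.
by move: s_le; rewrite ler_norml => /andP[]; lra.
Qed.

(** Proportionality to [w] is essential: the switching cost is then of the order of the gain
    [w * eta] that the drift provides. *)
Lemma upd_dist : `|upd g eta w e - w| <= w * (8 * eta).
Proof.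
apply: le_trans (clip_dist _ g_le_w w_le1) _.
move eqs : (eta * e - 64 * eta ^+ 2) => s.
have [s_le /andP[s1 s2] /andP[y1 y2]] := exponent_bounds (esym eqs).
move: g_gt0 g_le_w w_le1 eta_gt0 eta_le s_le s1 s2 y1 y2.
rewrite !ler_norml expr2 => ? ? ? ? ? /andP[? ?] ? ? ? ?.
by apply/andP; split; nra.
Qed.

(* The drift [64 * eta ^+ 2] in the exponent pays for the second-order term of
   the exponential and for the switching cost. *)
Lemma regret_base_step (w' := upd g eta w e) :
  - w * e + `|w' - w| <= (w - w') / eta + g / eta.
Proof.
rewrite -mulrDl ler_pdivlMr //.
have hd := upd_dist.
have w0 : 0 < w by move: g_gt0 g_le_w; lra.
have hy : w' <= w * expR (eta * e - 64 * eta ^+ 2) + g.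
  by rewrite clip_leD // mulr_gt0 ?expR_gt0.
move: hy hd; rewrite -/w'; move: w' => w'.
move eqs : (eta * e - 64 * eta ^+ 2) => s hy hd.
have [_ /andP[_ s2] /andP[_ y2]] := exponent_bounds (esym eqs).
have hee : eta * e = s + 64 * eta ^+ 2 by rewrite -eqs; ring.
have q1 : w * s ^+ 2 <= w * (16 * eta ^+ 2) by rewrite ler_pM2l.
have q2 : `|w' - w| * eta <= w * (8 * eta) * eta by rewrite ler_pM2r.
have q3 : 0 <= w * eta ^+ 2 by rewrite mulr_ge0 ?sqr_ge0 // ltW.
have -> : (- w * e + `|w' - w|) * eta = - w * (eta * e) + `|w' - w| * eta
  by ring.
rewrite hee; move: hy y2 q1 q2 q3; rewrite !expr2.
by move: (w * expR s) (`|w' - w| * eta) => A B; lra.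
Qed.

(** The logarithm turns the multiplicative update into a decrease by the exponent [s], so the
    potential drops by about [(1 - w) * s]. The drift now acts against the challenger, with factor
    [1 - w], whence [64 * eta]; the part [w] of the drift still covers [32 * eta ^+ 2] of second
    order and [8 * eta ^+ 2] of switching. *)
Lemma regret_challenger_step (w' := upd g eta w e) :
  (1 - w) * e + `|w' - w| <=
  (challenger_potential w - challenger_potential w') / eta + 64 * eta.
Proof.
have w0 : 0 < w by move: g_gt0 g_le_w; lra.
have hd := upd_dist.
have hH : challenger_potential w' <=
    challenger_potential (w * expR (eta * e - 64 * eta ^+ 2)).
  apply: challenger_potential_clip => //; first exact: le_trans w_le1.
  by rewrite mulr_gt0 ?expR_gt0.
move: hH hd; rewrite -/w' /challenger_potential; move: w' => w'.
rewrite lnM ?posrE ?expR_gt0 // expRK.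
move eqs : (eta * e - 64 * eta ^+ 2) => s hH hd.
rewrite -(ler_pM2r eta_gt0) [leRHS]mulrDl divfK ?gt_eqF //.
have [_ /andP[_ s2] /andP[_ y2]] := exponent_bounds (esym eqs).
have hee : eta * e = s + 64 * eta ^+ 2 by rewrite -eqs; ring.
have q1 : w * s ^+ 2 <= w * (16 * eta ^+ 2) by rewrite ler_pM2l.
have q2 : `|w' - w| * eta <= w * (8 * eta) * eta by rewrite ler_pM2r.
have q3 : 0 <= w * eta ^+ 2 by rewrite mulr_ge0 ?sqr_ge0 // ltW.
have -> : ((1 - w) * e + `|w' - w|) * eta =
  (1 - w) * (eta * e) + `|w' - w| * eta by ring.
rewrite hee; move: hH y2 q1 q2 q3; rewrite !expr2.
by move: (w * expR s) (`|w' - w| * eta) (ln w) (ln w') => A B C E; lra.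
Qed.

End step.
End one_level.

(** * The chain of levels *)

Section levels.
Context {R : realType}.
Variables (g : R) (eta : nat -> R).
Implicit Types (w a : nat -> R) (j J t : nat).

(* Expected cost, in one round with input costs [a], of the algorithm that
   combines the inputs [0, ..., j]: level [i] moves from input [i] to input
   [i.+1] with probability [w i], and [mix] charges to a round the cost of the
   switch that follows it. *)
Fixpoint mix w a j : R :=
  if j is i.+1 then
    let m := mix w a i in
    m - w i * (m - a i.+1) + `|upd g (eta i) (w i) (m - a i.+1) - w i|
  else a 0.

Definition next_weights w a j : R := upd g (eta j) (w j) (mix w a j - a j.+1).

Fixpoint weights (a : nat -> nat -> R) t : nat -> R :=
  if t is s.+1 then next_weights (weights a s) (a s) else fun=> g.

Hypotheses (g_gt0 : 0 < g) (g_le1 : g <= 1).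

Lemma weights_range (a : nat -> nat -> R) t j : g <= weights a t j <= 1.
Proof.
elim: t => [|t IH] /=; first by rewrite lexx g_le1.
by rewrite /next_weights /upd clip_ge ?clip_le1.
Qed.

Variable J : nat.
Hypotheses (eta_gt0 : forall j, 0 < eta j)
  (eta_le : forall j, (j < J)%N -> eta j <= 1 / 64)
  (eta_growth : forall j, 7 / 5 * eta j <= eta j.+1).

(** Switching charges do not accumulate along the chain: level [j] replaces a fraction [w j] of a
    mixture with excess up to [20 * eta j] by an input without excess, and pays only
    [8 * w j * eta j] for it. On active levels the excess is below 1, which keeps all gaps within
    3. *)
Lemma mix_range w a j : (forall i, g <= w i <= 1) -> (forall i, 0 <= a i <= 2) ->
  (j <= J)%N -> 0 <= mix w a j <= 2 + 20 * eta j.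
Proof.
move=> w01 a02; elim: j => [|j IH] jJ.
  by have := a02 0%N; have := eta_gt0 0 => /= ? /andP[? ?]; apply/andP; split; lra.
have /andP[m0 m1] := IH (ltnW jJ); rewrite /=; set m := mix w a j in m0 m1 *.
have /andP[a0 a2] := a02 j.+1; have /andP[gw w1] := w01 j.
have e0 := eta_gt0 j; have e1 := eta_le jJ; have e2 := eta_growth j.
have hd : `|upd g (eta j) (w j) (m - a j.+1) - w j| <= w j * (8 * eta j).
  apply: upd_dist => //; rewrite ler_norml; apply/andP; split; lra.
have n0 := normr_ge0 (upd g (eta j) (w j) (m - a j.+1) - w j).
move: hd n0; set n := `|_| => hd n0.
have w0 : 0 <= w j by move: g_gt0 gw; lra.
have ? : w j * (8 * eta j) <= 8 * eta j by rewrite ler_piMl //; lra.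
have ? : (1 - w j) * m <= (1 - w j) * (2 + 20 * eta j).
  by rewrite ler_wpM2l //; lra.
have ? : 0 <= (1 - w j) * m by rewrite mulr_ge0 //; lra.
have ? : w j * a j.+1 <= w j * 2 by rewrite ler_wpM2l.
have ? : 0 <= w j * a j.+1 by rewrite mulr_ge0.
have ? : 0 <= w j * eta j by rewrite mulr_ge0 // ltW.
by apply/andP; split; lra.
Qed.

(** A geometric sum of ratio [5 / 7], with [7 / 2 = 1 / (1 - 5 / 7)]; the induction carries the
    remaining tail along. The ratio [7 / 5] is a rational lower bound for the square root of 2. *)
Lemma sum_inv_eta u n : (u <= n)%N ->
  \sum_(u <= j < n) (eta j)^-1 <= 7 / 2 * (eta u)^-1.
Proof.
move=> un.
suff : \sum_(u <= j < n) (eta j)^-1 + 7 / 2 * (eta n)^-1 <= 7 / 2 * (eta u)^-1.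
  by apply: le_trans; rewrite lerDl mulr_ge0 ?invr_ge0 ?ltW //; lra.
elim: n un => [|n IH]; first by rewrite leqn0 => /eqP ->; rewrite big_geq // add0r.
rewrite leq_eqVlt => /predU1P[->|un]; first by rewrite big_geq // add0r.
rewrite big_nat_recr //=; apply: le_trans (IH un).
have : 7 / 5 / eta n.+1 <= (eta n)^-1.
  by rewrite ler_pdivrMr // [leRHS]mulrC ler_pdivlMr.
by move: (eta n.+1)^-1 (eta n)^-1 (eta u)^-1 => x y z; lra.
Qed.

Variable a : nat -> nat -> R.
Hypothesis a02 : forall t i, 0 <= a t i <= 2.
Local Notation W := (weights a).
Local Notation M := (fun t => mix (W t) (a t)).

Let gap_le3 t j : (j < J)%N -> `|M t j - a t j.+1| <= 3.
Proof.
move=> jJ; have /andP[? ?] := mix_range (weights_range a t) (a02 t) (ltnW jJ).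
have /andP[? ?] := a02 t j.+1; have := eta_le jJ => ?.
by rewrite ler_norml; apply/andP; split; lra.
Qed.

Lemma level_regret_base t0 k j : (j < J)%N ->
  \sum_(t0 <= t < t0 + k) M t j.+1 <= \sum_(t0 <= t < t0 + k) M t j +
    (W t0 j - W (t0 + k)%N j) / eta j + k%:R * (g / eta j).
Proof.
move=> jJ; elim: k => [|k IH].
  by rewrite addn0 subrr !mul0r !addr0 !big_geq.
rewrite addnS !big_nat_recr ?leq_addr //=.
have /andP[w0 w1] := weights_range a (t0 + k) j.
have := regret_base_step g_gt0 w0 w1 (eta_gt0 j) (eta_le jJ) (gap_le3 (t0 + k) jJ).
move: IH; rewrite /= -/(next_weights _ _ _) mulrSr.
set A := \sum_(_ <= _ < _) _; set B := \sum_(_ <= _ < _) _.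
by rewrite !mulrBl; lra.
Qed.

Lemma level_regret_challenger t0 k j : (j < J)%N ->
  \sum_(t0 <= t < t0 + k) M t j.+1 <= \sum_(t0 <= t < t0 + k) a t j.+1 +
    (1 - ln g) / eta j + 64 * k%:R * eta j.
Proof.
move=> jJ.
have {}H : \sum_(t0 <= t < t0 + k) M t j.+1 <=
    \sum_(t0 <= t < t0 + k) a t j.+1 + (challenger_potential (W t0 j) -
      challenger_potential (W (t0 + k)%N j)) / eta j + 64 * k%:R * eta j.
  elim: k => [|k IH]; first by rewrite addn0 subrr !mul0r mulr0 mul0r !addr0 !big_geq.
  rewrite addnS !big_nat_recr ?leq_addr //=.
  have /andP[w0 w1] := weights_range a (t0 + k) j.
  have := regret_challenger_step g_gt0 w0 w1 (eta_gt0 j) (eta_le jJ)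
    (gap_le3 (t0 + k) jJ).
  move: IH; rewrite /= -/(next_weights _ _ _) mulrSr.
  set A := \sum_(_ <= _ < _) _; set B := \sum_(_ <= _ < _) _.
  by rewrite !mulrBl; lra.
apply: le_trans H _; rewrite lerD2r lerD2l ler_pM2r ?invr_gt0 //.
have /andP[w0 w1] := weights_range a t0 j.
have /andP[v0 v1] := weights_range a (t0 + k) j.
(* The potential is at most [1 - ln g] at the start and positive at the end. *)
rewrite /challenger_potential.
have : ln g <= ln (W t0 j) by rewrite ler_ln ?posrE //; apply: lt_le_trans w0.
have := ln_le0 v1; move: g_gt0; lra.
Qed.

(** The parameter [c] bounds the weights at the start of the interval: it is [g] at time 0, for the
    regret to the base, and 1 for an interval that starts anywhere. *)
Lemma upper_levels_regret t0 k u c n : (u <= n)%N -> (n <= J)%N ->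
  (forall j, W t0 j <= c) ->
  \sum_(t0 <= t < t0 + k) M t n <= \sum_(t0 <= t < t0 + k) M t u +
    (c + k%:R * g) * (7 / 2 * (eta u)^-1).
Proof.
move=> un nJ Wc; have c0 : 0 < c.
  apply: lt_le_trans (Wc 0%N); have /andP[w0 _] := weights_range a t0 0.
  exact: lt_le_trans g_gt0 w0.
apply: (@le_trans _ _ (\sum_(t0 <= t < t0 + k) M t u +
    (c + k%:R * g) * \sum_(u <= j < n) (eta j)^-1)); last first.
  by rewrite lerD2l ler_wpM2l ?sum_inv_eta // addr_ge0 ?mulr_ge0 // ltW.
elim: n un nJ => [|n IH].
  rewrite leqn0 => /eqP -> _.
  by rewrite [\sum_(0 <= j < 0) _]big_geq // mulr0 addr0.
rewrite leq_eqVlt => /predU1P[->|un] nJ.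
  by rewrite [\sum_(n.+1 <= j < n.+1) _]big_geq // mulr0 addr0.
apply: le_trans (level_regret_base t0 k nJ) _.
have {}IH := IH un (ltnW nJ).
have key : (W t0 n - W (t0 + k)%N n) / eta n + k%:R * (g / eta n) <=
    (c + k%:R * g) * (eta n)^-1.
  rewrite mulrA -mulrDl ler_wpM2r ?invr_ge0 ?(ltW (eta_gt0 _)) // lerD2r.
  have /andP[v0 v1] := weights_range a (t0 + k) n.
  by rewrite lerBlDr (le_trans (Wc n)) // lerDl (le_trans (ltW g_gt0)).
rewrite [\sum_(u <= j < n.+1) _]big_nat_recr //= mulrDr -addrA [leRHS]addrA.
by apply: lerD; [exact: IH|exact: key].
Qed.

Lemma levels_regret_base k :
  \sum_(0 <= t < k) M t J <= \sum_(0 <= t < k) a t 0%N +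
    (1 + k%:R) * g * (7 / 2 * (eta 0)^-1).
Proof.
have := @upper_levels_regret 0 k 0 g J (leq0n _) (leqnn _) (fun=> lexx _).
by rewrite add0n [(1 + _) * g]mulrDl mul1r.
Qed.

Lemma levels_regret_challenger t0 k u : (u < J)%N ->
  \sum_(t0 <= t < t0 + k) M t J <= \sum_(t0 <= t < t0 + k) a t u.+1 +
    (1 - ln g) / eta u + 64 * k%:R * eta u +
    (1 + k%:R * g) * (7 / 2 * (eta u)^-1).
Proof.
move=> uJ; have g0 := ltW g_gt0.
apply: le_trans (upper_levels_regret k uJ (leqnn _) _) _.
  by move=> j; have /andP[_ h] := weights_range a t0 j; exact: h.
apply: lerD; first exact: level_regret_challenger.
rewrite ler_wpM2l ?addr_ge0 ?mulr_ge0 // ler_wpM2l //.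
rewrite lef_pV2 ?posrE //; have := eta_growth u; have := eta_gt0 u; lra.
Qed.

End levels.

(** * Running programs *)

Section big_step.
Context {R : realType} {L : nat}.
Variables (tape : nat -> R) (f : feedback R L).

(** Quantifying over the pending stack [k] makes exact step counts compose. *)
Definition runs (c : cmd) (s : store) (n : nat) (s' : store) : Prop :=
  forall k, iter n (step tape f) (c :: k, s) = (k, s').

Lemma runs_Do i s : runs (Do i) s 1 (exec_instr tape f i s).
Proof. by []. Qed.

Lemma runs_Seq c1 c2 s n1 n2 s1 s2 :
  runs c1 s n1 s1 -> runs c2 s1 n2 s2 -> runs (Seq c1 c2) s (n2 + n1).+1 s2.
Proof. by move=> r1 r2 k; rewrite iterSr iterD /= r1 r2. Qed.

Lemma runs_If b c1 c2 s n s' :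
  runs (if eval_test b s then c1 else c2) s n s' -> runs (If b c1 c2) s n.+1 s'.
Proof. by move=> r k; rewrite iterSr /= r. Qed.

Lemma runs_While_stop b c s : ~~ eval_test b s -> runs (While b c) s 1 s.
Proof. by move=> /negbTE bs k; rewrite /= bs. Qed.

Lemma runs_While_go b c s n1 n2 s1 s2 : eval_test b s ->
  runs c s n1 s1 -> runs (While b c) s1 n2 s2 ->
  runs (While b c) s (n2 + n1).+1 s2.
Proof. by move=> bs r1 r2 k; rewrite iterSr iterD /= bs r1 r2. Qed.

(** Each iteration costs one extra step to unfold the loop, and the final failing test costs one
    more. *)
Lemma runs_for b c (P : nat -> store -> Prop) (K n : nat) s :
  (forall j s, P j s -> eval_test b s = (j < n)%N) ->
  (forall j s, (j < n)%N -> P j s ->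
    exists m s', [/\ (m <= K)%N, runs c s m s' & P j.+1 s']) ->
  P 0%N s ->
  exists m s', [/\ (m <= (K.+1 * n).+1)%N, runs (While b c) s m s' & P n s'].
Proof.
move=> Pb Pc.
suff H d i s' : (i + d)%N = n -> P i s' -> exists m s'',
    [/\ (m <= (K.+1 * d).+1)%N, runs (While b c) s' m s'' & P n s''].
  exact: H (add0n n).
elim: d i s' => [|d IH] i s' idn Pi.
  rewrite addn0 in idn; exists 1%N, s'; split; rewrite -?idn //.
  by apply: runs_While_stop; rewrite (Pb _ _ Pi) idn ltnn.
have i_n : (i < n)%N by lia.
have [m1 [s1 [m1K r1 P1]]] := Pc _ _ i_n Pi.
have [|m2 [s2 [m2K r2 P2]]] := IH i.+1 s1 _ P1; first by lia.
exists (m2 + m1).+1, s2; split=> //; first by nia.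
by apply: runs_While_go r1 r2; rewrite (Pb _ _ Pi).
Qed.

Lemma exec_runs budget c s n s' : (n <= budget)%N ->
  runs c s n s' -> exec tape f budget c s = Some s'.
Proof.
move=> n_le r; rewrite /exec -(subnK n_le) iterD r.
suff -> m : iter m (step tape f) ([::], s') = ([::], s') by [].
by elim: m => //= m ->.
Qed.

Definition block (l : seq instr) : cmd := foldr (fun i => Seq (Do i)) Skip l.

Lemma runs_block l s :
  runs (block l) s (2 * size l).+1 (foldl (fun s i => exec_instr tape f i s) s l).
Proof.
elim: l s => [|i l IH] s //=.
have := runs_Seq (runs_Do i s) (IH (exec_instr tape f i s)).
by congr (runs _ _ _ _); lia.
Qed.

Definition same_except (ns rs : seq nat) (s s' : @store R) : Prop :=
  (forall k, k \notin ns -> nmem s' k = nmem s k) /\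
  (forall k, k \notin rs -> rmem s' k = rmem s k).

Lemma same_except_trans ns rs s1 s2 s3 : same_except ns rs s1 s2 ->
  same_except ns rs s2 s3 -> same_except ns rs s1 s3.
Proof. by move=> [n1 r1] [n2 r2]; split=> k kn; rewrite ?n2 ?n1 ?r2 ?r1. Qed.

End big_step.

(** * The program and its correctness *)

(* Natural cells: 0 output, 4 the number [j.+1] of the current input, 5 and 9
   the constants 1 and 2, 6 and 7 the addresses of [w j] and of the threshold of
   level [j], 8 the number of levels, 10 the number of inputs but one, 12 zero.
   Real cells: 0 [D], 1 floor, 2 [eta j], 3 [sqrt 2], 4 [1 / 64], 5 one,
   6 [mix w a j], 10 [64], 11 [eta 0], 12 zero; [w j] is in cell [2 j + 20] and
   the threshold of level [j] in cell [2 j + 21]. *)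
Definition init_head : seq instr :=
  [:: NConst (Cell 4) 1; NConst (Cell 5) 1; NConst (Cell 6) 20;
      NConst (Cell 7) 21; NConst (Cell 8) 0; NConst (Cell 9) 2;
      NConst (Cell 0) 0; NConst (Cell 12) 0; NAdd (Cell 10) (Cell 3) (Cell 5);
      NConst (Cell 11) 5; NConst (Cell 13) 64;
      ROfNat (Cell 5) (Cell 5); ROfNat (Cell 12) (Cell 12);
      ROfNat (Cell 10) (Cell 13); ROp2 Div (Cell 4) (Cell 5) (Cell 10);
      ROfNat (Cell 8) (Cell 9); ROp2 Div (Cell 9) (Cell 5) (Cell 8);
      ROp2 Pow (Cell 3) (Cell 8) (Cell 9);
      ROfNat (Cell 6) (Cell 3); ROfNat (Cell 7) (Cell 1);
      ROp2 Div (Cell 11) (Cell 6) (Cell 7);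
      ROp2 Pow (Cell 11) (Cell 11) (Cell 9);
      ROp2 Add (Cell 2) (Cell 11) (Cell 12);
      ROfNat (Cell 8) (Cell 11); ROp2 Mul (Cell 8) (Cell 8) (Cell 6);
      ROp2 Defs.Sub (Cell 8) (Cell 12) (Cell 8); ROp1 Exp (Cell 1) (Cell 8)].

(** Adding the zero of real cell 12 serves as a copy instruction. A sample is drawn for dropped
    levels too, so the threshold of level [j] is sample number [j]. *)
Definition init_level : seq instr :=
  [:: Sample (At 7); ROp2 Add (At 6) (Cell 1) (Cell 12)].

Definition count_level : cmd := Do (NAdd (Cell 8) (Cell 4) (Cell 12)).

(** Levels are visited upwards and a success overwrites cell 0, so the highest level whose threshold
    is at most its weight decides, as in [sel]. *)
Definition select_level : cmd :=
  If (RLe (At 7) (At 6)) (Do (NAdd (Cell 0) (Cell 4) (Cell 12))) Skip.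

Definition next_level : seq instr :=
  [:: ROp2 Mul (Cell 2) (Cell 2) (Cell 3); NAdd (Cell 4) (Cell 4) (Cell 5);
      NAdd (Cell 6) (Cell 6) (Cell 9); NAdd (Cell 7) (Cell 7) (Cell 9)].

Definition init_body : cmd :=
  Seq (block init_level)
    (Seq (If (RLe (Cell 2) (Cell 4)) (Seq count_level select_level) Skip)
         (block next_level)).

Definition round_head : seq instr :=
  [:: NConst (Cell 4) 1; NConst (Cell 6) 20; NConst (Cell 7) 21;
      NConst (Cell 0) 0; ROp2 Add (Cell 2) (Cell 11) (Cell 12);
      ReadLoss (Cell 6) (Cell 12); ROp2 Div (Cell 6) (Cell 6) (Cell 0);
      ReadSwitch (Cell 11) (Cell 12); ROfNat (Cell 7) (Cell 11);
      ROp2 Add (Cell 6) (Cell 6) (Cell 7)].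

(** Leaves the gap in real cell 7, the unclipped new weight in cell 8 and the old weight in cell 9;
    the old one is still needed after its own cell is overwritten. *)
Definition gap_and_exponential : seq instr :=
  [:: ReadLoss (Cell 7) (Cell 4); ROp2 Div (Cell 7) (Cell 7) (Cell 0);
      ReadSwitch (Cell 11) (Cell 4); ROfNat (Cell 8) (Cell 11);
      ROp2 Add (Cell 7) (Cell 7) (Cell 8); ROp2 Defs.Sub (Cell 7) (Cell 6) (Cell 7);
      ROp2 Mul (Cell 8) (Cell 2) (Cell 7); ROp2 Mul (Cell 9) (Cell 2) (Cell 2);
      ROp2 Mul (Cell 9) (Cell 10) (Cell 9); ROp2 Defs.Sub (Cell 8) (Cell 8) (Cell 9);
      ROp1 Exp (Cell 8) (Cell 8); ROp2 Add (Cell 9) (At 6) (Cell 12);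
      ROp2 Mul (Cell 8) (Cell 9) (Cell 8)].

Definition clip_weight : cmd :=
  If (RLe (Cell 5) (Cell 8)) (Do (ROp2 Add (Cell 8) (Cell 5) (Cell 12)))
    (If (RLe (Cell 8) (Cell 1)) (Do (ROp2 Add (Cell 8) (Cell 1) (Cell 12))) Skip).

Definition store_weight : seq instr :=
  [:: ROp2 Add (At 6) (Cell 8) (Cell 12); ROp2 Mul (Cell 7) (Cell 9) (Cell 7);
      ROp2 Defs.Sub (Cell 6) (Cell 6) (Cell 7)].

Definition abs_diff : cmd :=
  If (RLe (Cell 9) (Cell 8)) (Do (ROp2 Defs.Sub (Cell 8) (Cell 8) (Cell 9)))
    (Do (ROp2 Defs.Sub (Cell 8) (Cell 9) (Cell 8))).

Definition round_body : cmd :=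
  Seq (block gap_and_exponential) (Seq clip_weight (Seq (block store_weight)
    (Seq abs_diff (Seq (Do (ROp2 Add (Cell 6) (Cell 6) (Cell 8)))
      (Seq select_level (block next_level)))))).

Definition combine : program :=
  Program (Seq (block init_head) (While (NLe (Cell 4) (Cell 10)) init_body))
          (Seq (block round_head) (While (NLe (Cell 4) (Cell 8)) round_body)).

(* Written with successors so that comparisons with numerals compute. *)
Local Notation waddr j := (j.*2.+4.+4.+4.+4.+4).

(** * The program computes the weight recursion and the threshold selection *)

Section correctness.
Context {R : realType}.

Fixpoint sel (r w : nat -> R) (n : nat) : nat :=
  if n is i.+1 then if r i <= w i then i.+1 else sel r w i else 0.

Lemma sel_le (r w : nat -> R) n : (sel r w n <= n)%N.
Proof. by elim: n => //= n IH; case: ifP => // _; rewrite ltnW. Qed.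

Fixpoint nlevels (eta : nat -> R) (n : nat) : nat :=
  if n is i.+1 then if eta i <= 1 / 64 then i.+1 else nlevels eta i else 0.

Lemma nlevels_le eta n : (nlevels eta n <= n)%N.
Proof. by elim: n => //= n IH; case: ifP => // _; rewrite ltnW. Qed.

(* The input costs in one round, with [D] as the unit of cost. *)
Definition input_cost (D : R) L (f : feedback R L) (i : nat) : R :=
  (f (inord i)).1 / D + (f (inord i)).2%:R.

Section run.
Variables (L T N : nat) (D g rho : R) (eta : nat -> R) (tape : nat -> R).
Hypotheses (etaS : forall j, eta j.+1 = eta j * rho)
  (eta_mono : forall j, eta j <= eta j.+1).

(** The rates are nondecreasing, so the active levels form a prefix; this is why [count_level] may
    simply record the latest active index. *)
Lemma nlevels_active n : eta n <= 1 / 64 -> nlevels eta n = n.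
Proof.
elim: n => //= n IH etan; have etan' : eta n <= 1 / 64 by apply: le_trans etan.
by rewrite etan'.
Qed.

Local Notation J := (nlevels eta L.+1).

Lemma active_lt_nlevels n j : (j < nlevels eta n)%N -> eta j <= 1 / 64.
Proof.
elim: n => //= n IH; case: ifP => // etan.
rewrite ltnS => jn; apply: le_trans etan.
rewrite -(subnKC jn); elim: (n - j)%N => [|d IHd]; first by rewrite addn0.
by rewrite addnS (le_trans IHd).
Qed.

Definition constants (s : @store R) : Prop :=
  [/\ nmem s 5 = 1%N, nmem s 9 = 2%N, nmem s 12 = 0%N &
    [/\ rmem s 0 = D, rmem s 1 = g, rmem s 3 = rho & rmem s 4 = 1 / 64] /\
    [/\ rmem s 5 = 1, rmem s 10 = 64, rmem s 11 = eta 0 & rmem s 12 = 0]].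

Definition pointers j (s : @store R) : Prop :=
  [/\ nmem s 4 = j.+1, nmem s 6 = (waddr j), nmem s 7 = (waddr j).+1 &
      rmem s 2 = eta j].

Definition holds_levels n (w : nat -> R) (s : @store R) : Prop :=
  forall i, (i < n)%N -> rmem s (waddr i) = w i /\ rmem s (waddr i).+1 = tape i.

Definition init_inv j (s : @store R) : Prop :=
  [/\ constants s, pointers j s, holds_levels j (fun=> g) s,
      drawn s = j & [/\ nmem s 8 = nlevels eta j, nmem s 10 = L.+1 &
      nmem s 0 = sel tape (fun=> g) (nlevels eta j)]].

(** The side conditions are boolean tests on explicit lists; with weight addresses in successor form
    they reduce to [true] even for a variable level. *)
Lemma constants_same ns rs s s' : same_except ns rs s s' ->
  all [pred k | k \notin ns] [:: 5; 9; 12]%N ->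
  all [pred k | k \notin rs] [:: 0; 1; 3; 4; 5; 10; 11; 12]%N ->
  constants s -> constants s'.
Proof.
move=> [hn hr] /allP an /allP ar [? ? ? [[? ? ? ?] [? ? ? ?]]].
by split; [| | |split; split]; rewrite ?hn ?hr //; do ?[exact: an|exact: ar].
Qed.

Lemma pointers_same ns rs j s s' : same_except ns rs s s' ->
  all [pred k | k \notin ns] [:: 4; 6; 7]%N -> 2%N \notin rs ->
  pointers j s -> pointers j s'.
Proof.
move=> [hn hr] /allP an ar [? ? ? ?].
by split; rewrite ?hn ?hr //; exact: an.
Qed.

Section on_feedback.
Variable f : feedback R L.
Local Notation runs := (runs tape f).

Lemma runs_select_level j (w x : R) s : constants s -> pointers j s ->
  rmem s (waddr j) = w -> rmem s (waddr j).+1 = x ->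
  exists n s', [/\ (n <= 2)%N, runs select_level s n s',
    nmem s' 0 = if x <= w then j.+1 else nmem s 0,
    same_except [:: 0%N] [::] s s' & drawn s' = drawn s].
Proof.
move=> [_ _ c12 _] [p4 p6 p7 _] hw hx.
exists 2%N, (if x <= w
  then exec_instr tape f (NAdd (Cell 0) (Cell 4) (Cell 12)) s else s).
have test : eval_test (RLe (At 7) (At 6)) s = (x <= w).
  by rewrite /= /rget /= p6 p7 hw hx.
split=> //.
- by apply: runs_If; rewrite test; case: ifP.
- by case: ifP => //= _; rewrite /nget /= p4 c12 addn0.
- case: ifP => // _; split=> //= k; rewrite inE => /negbTE.
  by rewrite /nset /= => ->.
- by case: ifP.
Qed.

Lemma runs_next_level j s : constants s -> pointers j s ->
  exists s', [/\ runs (block next_level) s 9 s', pointers j.+1 s',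
    same_except [:: 4; 6; 7]%N [:: 2%N] s s' & drawn s' = drawn s].
Proof.
move=> [c5 c9 c12 [[_ _ r3 _] _]] [p4 p6 p7 p2].
exists (foldl (fun s i => exec_instr tape f i s) s next_level).
split=> //.
  by split; rewrite /= /nget /rget /= ?p4 ?p6 ?p7 ?p2 ?r3 ?c5 ?c9 ?etaS //; lia.
split=> k; rewrite !inE ?negb_or.
  by case/and3P=> /negbTE h4 /negbTE h6 /negbTE h7; rewrite /= h7 h6 h4.
by move/negbTE=> h2; rewrite /= h2.
Qed.

Lemma runs_init_body j s : init_inv j s ->
  exists m s', [/\ (m <= 40)%N, runs init_body s m s' & init_inv j.+1 s'].
Proof.
case=> cs ps hs ds [c8 c10 c0].
pose s1 := foldl (fun s i => exec_instr tape f i s) s init_level.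
have r1 : runs (block init_level) s 5 s1 by exact: runs_block.
have [p4 p6 p7 p2] := ps; have [_ _ _ [[_ e1 _ e4] [_ _ _ e12]]] := cs.
have sm1 : same_except [::] [:: waddr j; (waddr j).+1] s s1.
  split=> k; rewrite ?inE ?negb_or => /=; first by [].
  by case/andP=> /negbTE h1 /negbTE h2; rewrite /= p6 p7 h1 h2.
have w1 : rmem s1 (waddr j) = g.
  by rewrite /= p6 eqxx /rget /= p7 e1 e12 addr0.
have t1 : rmem s1 (waddr j).+1 = tape j.
  rewrite /= p6 p7 /= ds; case: eqP => [h|]; first by move: h; lia.
  by rewrite eqxx.
have d1 : drawn s1 = j.+1 by rewrite /= ds.
have cs1 : constants s1 by exact: constants_same sm1 _ _ cs.
have ps1 : pointers j s1 by exact: pointers_same sm1 _ _ ps.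
clearbody s1.
have [m2 [s2 [m2_le r2 sm2 d2 [n8 n0]]]] : exists m s2, [/\ (m <= 5)%N,
    runs (If (RLe (Cell 2) (Cell 4)) (Seq count_level select_level) Skip) s1 m s2,
    same_except [:: 0; 8]%N [::] s1 s2, drawn s2 = drawn s1 &
    nmem s2 8 = nlevels eta j.+1 /\
    nmem s2 0 = sel tape (fun=> g) (nlevels eta j.+1)].
  have test : eval_test (RLe (Cell 2) (Cell 4)) s1 = (eta j <= 1 / 64).
    by have [_ _ _ q2] := ps1; have [_ _ _ [[_ _ _ q4] _]] := cs1;
       rewrite /= /rget /= q2 q4.
  case etaj : (eta j <= 1 / 64); last first.
    exists 2%N, s1; split=> //; first by apply: runs_If; rewrite test etaj.
    by rewrite /= etaj -c0 -c8; case: sm1 => h _; rewrite !h.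
  pose s2 := exec_instr tape f (NAdd (Cell 8) (Cell 4) (Cell 12)) s1.
  have sm2 : same_except [:: 0; 8]%N [::] s1 s2.
    by split=> k //; rewrite !inE negb_or => /andP[_ /negbTE h]; rewrite /= h.
  have cs2 : constants s2 by exact: constants_same sm2 _ _ cs1.
  have ps2 : pointers j s2 by exact: pointers_same sm2 _ _ ps1.
  have [m [s3 [m3 r3 o3 sm3 d3]]] := runs_select_level cs2 ps2 w1 t1.
  exists (m + 1).+2, s3; split=> //; first by lia.
  - apply: runs_If; rewrite test etaj; apply: runs_Seq r3; exact: runs_Do.
  - apply: same_except_trans sm2 _; case: sm3 => h1 h2; split=> // k.
    by rewrite !inE negb_or => /andP[k0 _]; apply: h1; rewrite inE.
  split.
    case: sm3 => -> // _; case: ps1 => q4 _ _ _; case: cs1 => _ _ q12 _.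
    by rewrite /= /nget /= q4 q12 addn0 etaj.
  rewrite o3 /= etaj /=; case: ifP => // _.
  by rewrite -[j in RHS](nlevels_active etaj) -c0; case: sm1 => -> .
have cs2 : constants s2 by exact: constants_same sm2 _ _ cs1.
have ps2 : pointers j s2 by exact: pointers_same sm2 _ _ ps1.
have [s3 [r3 ps3 sm3 d3]] := runs_next_level cs2 ps2.
exists (((9 + m2).+1) + 5).+1, s3; split; first by lia.
  by apply: runs_Seq r1 _; apply: runs_Seq r2 _.
have cs3 : constants s3 by exact: constants_same sm3 _ _ cs2.
case: sm3 => nm3 rm3; case: sm2 => nm2 rm2; case: sm1 => nm1 rm1.
split=> //; last first.
- by rewrite !nm3 // n8 n0 nm2 // nm1.
- by rewrite d3 d2 d1.
move=> i; rewrite ltnS leq_eqVlt => /predU1P[->|ij].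
  by rewrite !rm3 ?inE // !rm2.
have [h1 h2] := hs i ij; rewrite !rm3 ?inE // !rm2 // !rm1 //.
  by rewrite !inE; lia.
by rewrite !inE; lia.
Qed.

Lemma runs_init : eta 0 = (L%:R / T%:R) `^ (1 / 2%:R) -> rho = 2%:R `^ (1 / 2%:R) ->
  g = expR (0 - 5%:R * L%:R) ->
  exists m s, [/\ (m <= 100 * L.+1)%N,
    runs (prog_init combine) (initial_store T N L D) m s & init_inv L.+1 s].
Proof.
move=> eta0E rhoE gE.
set s0 := initial_store T N L D.
pose s1 := foldl (fun s i => exec_instr tape f i s) s0 init_head.
have r1 : runs (block init_head) s0 55 s1 by exact: runs_block.
have [c4 c6 c7] : [/\ nmem s1 4 = 1, nmem s1 6 = 20 & nmem s1 7 = 21]%N by split; exact: erefl.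
have [c5 c9 c12 c8 c0] : [/\ nmem s1 5 = 1, nmem s1 9 = 2, nmem s1 12 = 0,
  nmem s1 8 = 0 & nmem s1 0 = 0]%N by split; exact: erefl.
have e12 : rmem s1 12 = 0%:R by [].
have e5 : rmem s1 5 = 1%:R by [].
have e10 : rmem s1 10 = 64%:R by [].
have e4 : rmem s1 4 = 1%:R / 64%:R by [].
have e0 : rmem s1 0 = D by [].
have e3 : rmem s1 3 = 2%:R `^ (1%:R / 2%:R) by [].
have e11 : rmem s1 11 = (L%:R / T%:R) `^ (1%:R / 2%:R) by [].
have e2 : rmem s1 2 = (L%:R / T%:R) `^ (1%:R / 2%:R) + 0%:R by [].
have e1 : rmem s1 1 = expR (0%:R - 5%:R * L%:R) by [].
have d1 : drawn s1 = 0%N by [].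
have c10 : nmem s1 10 = (L + 1)%N by exact: erefl.
clearbody s1; rewrite -eta0E in e11 e2; rewrite -rhoE in e3; rewrite -gE in e1.
rewrite addr0 in e2; rewrite addn1 in c10.
have inv1 : init_inv 0 s1 by [].
have [] := @runs_for R L tape f (NLe (Cell 4) (Cell 10)) init_body init_inv
  40 L.+1 s1 _ _ inv1.
- by move=> j s [_ [p4 _ _ _] _ _ [_ q10 _]]; rewrite /= /nget /= p4 q10.
- by move=> j s _; exact: runs_init_body.
(* In total [41 * L.+1 + 57] steps at most; for [L = 0] this is 98, the origin of the factor 100 in
   the budget. *)
move=> m [s2 [m_le r2 inv2]]; exists (m + 55).+1, s2; split=> //; first by lia.
exact: runs_Seq r1 r2.
Qed.

Variables (n : nat) (w : nat -> R).
Local Notation a := (input_cost D f).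
Local Notation next := (next_weights g eta w a).
Local Notation mix := (mix g eta w a).

Definition ready v s : Prop :=
  [/\ constants s, nmem s 8 = n, nmem s 0 = sel tape v n & holds_levels n v s].

Definition round_inv j s : Prop :=
  [/\ constants s, pointers j s, rmem s 6 = mix j,
    holds_levels n (fun i => if (i < j)%N then next i else w i) s &
    nmem s 8 = n /\ nmem s 0 = sel tape next j].

Lemma runs_clip y s : constants s -> rmem s 8 = y ->
  exists m s', [/\ (m <= 3)%N, runs clip_weight s m s', rmem s' 8 = clip g y &
    same_except [::] [:: 8%N] s s'].
Proof.
move=> [_ _ _ [[_ e1 _ _] [e5 _ _ e12]]] hy.
have t1 : eval_test (RLe (Cell 5) (Cell 8)) s = (1 <= y).
  by rewrite /= /rget /= e5 hy.
have t2 : eval_test (RLe (Cell 8) (Cell 1)) s = (y <= g).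
  by rewrite /= /rget /= e1 hy.
have sm i : same_except [::] [:: 8%N] s
    (exec_instr tape f (ROp2 Add (Cell 8) i (Cell 12)) s).
  by split=> k //; rewrite inE => /negbTE h; rewrite /= h.
rewrite /clip; case: ifP => h1.
  exists 2%N, (exec_instr tape f (ROp2 Add (Cell 8) (Cell 5) (Cell 12)) s).
  split=> //; first by apply: runs_If; rewrite t1 h1.
  by rewrite /= /rget /= e5 e12 addr0.
case: ifP => h2.
  exists 3%N, (exec_instr tape f (ROp2 Add (Cell 8) (Cell 1) (Cell 12)) s).
  split=> //; first by apply: runs_If; rewrite t1 h1; apply: runs_If; rewrite t2 h2.
  by rewrite /= /rget /= e1 e12 addr0.
exists 3%N, s; split=> //.
by apply: runs_If; rewrite t1 h1; apply: runs_If; rewrite t2 h2.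
Qed.

Lemma runs_abs_diff x y s : rmem s 8 = x -> rmem s 9 = y ->
  exists m s', [/\ (m <= 2)%N, runs abs_diff s m s', rmem s' 8 = `|x - y| &
    same_except [::] [:: 8%N] s s'].
Proof.
move=> hx hy; exists 2%N, (exec_instr tape f (if y <= x then
  ROp2 Defs.Sub (Cell 8) (Cell 8) (Cell 9) else
  ROp2 Defs.Sub (Cell 8) (Cell 9) (Cell 8)) s).
split=> //.
- by apply: runs_If; rewrite /= /rget /= hx hy; case: ifP.
- case: leP => h; rewrite /= /rget /= hx hy; first by rewrite ger0_norm ?subr_ge0.
  by rewrite ltr0_norm ?subr_lt0 // opprB.
- by case: ifP => _; split=> k //; rewrite inE => /negbTE h; rewrite /= h.
Qed.

Local Notation scratch := [:: 6; 7; 8; 9]%N.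

Lemma runs_round_body j s : (j < n)%N -> round_inv j s ->
  exists m s', [/\ (m <= 60)%N, runs round_body s m s' & round_inv j.+1 s'].
Proof.
move=> jn [cs ps s6 hs [c8 c0]].
have [p4 p6 p7 p2] := ps; have [_ _ _ [[e0 e1 _ e4] [_ e10 _ e12]]] := cs.
have [hw ht] := hs j jn; rewrite ltnn in hw.
pose e := mix j - a j.+1.
pose s1 := foldl (fun s i => exec_instr tape f i s) s gap_and_exponential.
have r1 : runs (block gap_and_exponential) s 27 s1 by exact: runs_block.
have sm1 : same_except [:: 11%N] [:: 7; 8; 9]%N s s1.
  split=> k; rewrite ?inE ?negb_or.
    by move/negbTE=> h; rewrite /= h.
  by case/and3P=> /negbTE h7 /negbTE h8 /negbTE h9; rewrite /= h7 h8 h9.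
have e7 : rmem s1 7 = e.
  by rewrite /= /rget /= /nget /= p4 e0 s6.
have e9 : rmem s1 9 = w j by rewrite /= /rget /= p6 hw e12 addr0.
have e8 : rmem s1 8 = w j * expR (eta j * e - 64 * eta j ^+ 2).
  by rewrite /= /rget /= /nget /= p4 p6 hw e0 s6 p2 e10 e12 addr0 expr2.
have cs1 : constants s1 by exact: constants_same sm1 _ _ cs.
have ps1 : pointers j s1 by exact: pointers_same sm1 _ _ ps.
clearbody s1.
have [m2 [s2 [m2_le r2 o2 sm2]]] := runs_clip cs1 e8.
have cs2 : constants s2 by exact: constants_same sm2 _ _ cs1.
have ps2 : pointers j s2 by exact: pointers_same sm2 _ _ ps1.
have [q4 q6 q7 q2] := ps2; have [_ _ _ [_ [_ _ _ e12']]] := cs2.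
pose s3 := foldl (fun s i => exec_instr tape f i s) s2 store_weight.
have r3 : runs (block store_weight) s2 7 s3 by exact: runs_block.
have sm3 : same_except [::] [:: 6; 7; waddr j]%N s2 s3.
  split=> k; rewrite ?inE ?negb_or // => /and3P[/negbTE h6 /negbTE h7 /negbTE h8].
  by rewrite /= q6 h6 h7 h8.
have nx : rmem s2 8 = next j by rewrite o2.
have f9 : rmem s2 9 = w j by case: sm2 => _ -> //.
have f7 : rmem s2 7 = e by case: sm2 => _ -> //.
have f6 : rmem s2 6 = mix j by case: sm2 => _ -> //; case: sm1 => _ -> //.
have h3w : rmem s3 (waddr j) = next j.
  by rewrite /= q6 eqxx /rget /= nx e12' addr0.
have h38 : rmem s3 8 = next j by rewrite /= q6 /= nx.
have h39 : rmem s3 9 = w j by rewrite /= q6 /= f9.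
have h36 : rmem s3 6 = mix j - w j * e.
  by rewrite /= ?q6 /= /rget /= ?q6 /= f6 f7 f9.
have cs3 : constants s3 by exact: constants_same sm3 _ _ cs2.
have ps3 : pointers j s3 by exact: pointers_same sm3 _ _ ps2.
clearbody s3.
have [m4 [s4 [m4_le r4 o4 sm4]]] := runs_abs_diff h38 h39.
have cs4 : constants s4 by exact: constants_same sm4 _ _ cs3.
have ps4 : pointers j s4 by exact: pointers_same sm4 _ _ ps3.
pose s5 := exec_instr tape f (ROp2 Add (Cell 6) (Cell 6) (Cell 8)) s4.
have sm5 : same_except [::] [:: 6%N] s4 s5.
  by split=> k //; rewrite inE => /negbTE h; rewrite /= h.
have h56 : rmem s5 6 = mix j.+1.
  by rewrite /= /rget /= o4; case: sm4 => _ -> //; rewrite h36.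
have cs5 : constants s5 by exact: constants_same sm5 _ _ cs4.
have ps5 : pointers j s5 by exact: pointers_same sm5 _ _ ps4.
have r5 : runs (Do (ROp2 Add (Cell 6) (Cell 6) (Cell 8))) s4 1 s5 by [].
clearbody s5.
have nm k : k != 11%N -> nmem s5 k = nmem s k.
  move=> k11; case: sm5 => -> // _; case: sm4 => -> // _; case: sm3 => -> // _.
  by case: sm2 => -> // _; case: sm1 => -> //; rewrite inE.
have rm k : k \notin [:: 6; 7; 8; 9]%N -> k != waddr j -> rmem s5 k = rmem s k.
  rewrite !inE !negb_or => /and4P[k6 k7 k8 k9] kw.
  case: sm5 => _ ->; last by rewrite inE.
  case: sm4 => _ ->; last by rewrite inE.
  case: sm3 => _ ->; last by rewrite !inE !negb_or k6 k7.
  case: sm2 => _ ->; last by rewrite inE.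
  by case: sm1 => _ ->; rewrite // !inE !negb_or k7 k8.
have h5w : rmem s5 (waddr j) = next j.
  by case: sm5 => _ -> //; case: sm4 => _ -> //.
have h5t : rmem s5 (waddr j).+1 = tape j.
  by rewrite rm ?ht // eqn_leq ltnn.
have [m6 [s6' [m6_le r6 o6 sm6 _]]] := runs_select_level cs5 ps5 h5w h5t.
have cs6 : constants s6' by exact: constants_same sm6 _ _ cs5.
have ps6 : pointers j s6' by exact: pointers_same sm6 _ _ ps5.
have [s7 [r7 ps7 sm7 _]] := runs_next_level cs6 ps6.
have cs7 : constants s7 by exact: constants_same sm7 _ _ cs6.
exists (((((((9 + m6).+1 + 1).+1 + m4).+1 + 7).+1 + m2).+1 + 27).+1), s7.
case: sm7 => nm7 rm7; case: sm6 => nm6 rm6.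
split.
- lia.
- by do 5!(apply: runs_Seq; [by eassumption|]); apply: runs_Seq r6 r7.
split=> //.
- by rewrite rm7 // rm6 // h56.
- move=> i i_n; rewrite ltnS !rm7 ?inE // !rm6 //.
  have [hwi hti] := hs i i_n.
  rewrite [rmem _ (waddr i).+1]rm // ?hti; last by apply/eqP; lia.
  split=> //; have [->|ij] := eqVneq i j; first by rewrite leqnn h5w.
  rewrite leq_eqVlt (negbTE ij) /= rm ?hwi //.
  by apply: contra ij => /eqP ?; apply/eqP; lia.
rewrite !nm7 // nm6 // nm // c8; split=> //.
by rewrite o6 nm // c0 /=; case: ifP.
Qed.

Lemma runs_round s : (n <= L.+1)%N -> ready w s ->
  exists m s', [/\ (m <= 100 * L.+1)%N, runs (prog_round combine) s m s' &
    ready next s'].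
Proof.
move=> nL [cs c8 c0 hs].
pose s1 := foldl (fun s i => exec_instr tape f i s) s round_head.
have r1 : runs (block round_head) s 21 s1 by exact: runs_block.
have sm1 : same_except [:: 0; 4; 6; 7; 11]%N [:: 2; 6; 7]%N s s1.
  split=> k; rewrite !inE !negb_or.
    by case/and5P=> /negbTE h1 /negbTE h2 /negbTE h3 /negbTE h4 /negbTE h5;
       rewrite /= h1 h2 h3 h4 h5.
  by case/and3P=> /negbTE h1 /negbTE h2 /negbTE h3; rewrite /= h1 h2 h3.
have [_ _ c12 [[e0 _ _ _] [_ _ e11 e12]]] := cs.
have inv1 : round_inv 0 s1.
  split.
  - exact: constants_same sm1 _ _ cs.
  - by split=> //; rewrite /= /rget /= e11 e12 addr0.
  - by rewrite /= /rget /= /nget /= c12 e0.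
  - by move=> i i_n; have := hs i i_n; case: sm1 => _ h; rewrite !h.
  - by case: sm1 => h _; rewrite h.
have [] := @runs_for R L tape f (NLe (Cell 4) (Cell 8)) round_body round_inv
  60 n s1 _ _ inv1.
- by move=> j s' [_ [p4 _ _ _] _ _ [q8 _]]; rewrite /= /nget /= p4 q8.
- by move=> j s'; exact: runs_round_body.
move=> m [s2 [m_le r2 [cs2 _ _ hs2 [q8 q0]]]]; exists (m + 21).+1, s2.
split; first by nia.
  exact: runs_Seq r1 r2.
by split=> // i i_n; have := hs2 i i_n; rewrite i_n.
Qed.

End on_feedback.
End run.

(** This expression and [floor_weight] keep the literal form in which the program evaluates them, so
    that they match the final store by conversion. *)
Definition rate (L T : nat) (j : nat) : R :=
  (L%:R / T%:R) `^ (1 / 2%:R) * (2%:R `^ (1 / 2%:R)) ^+ j.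

Definition floor_weight (L : nat) : R := expR (0 - 5%:R * L%:R).

Definition depth (L T : nat) : nat := nlevels (rate L T) L.+1.

Definition weights_after (D : R) (L T : nat) (fs : seq (feedback R L)) :
    nat -> R :=
  foldl (fun w f => next_weights (floor_weight L) (rate L T) w (input_cost D f))
        (fun=> floor_weight L) fs.

Lemma rateS L T j : rate L T j.+1 = rate L T j * 2%:R `^ (1 / 2%:R).
Proof. by rewrite /rate exprSr mulrA. Qed.

Lemma sqrt2_sqr : 2%:R `^ (1 / 2%:R) * 2%:R `^ (1 / 2%:R) = 2 :> R.
Proof. by rewrite div1r powR12_sqrt // -expr2 sqr_sqrtr. Qed.

Lemma rate_growth L T j : 7 / 5 * rate L T j <= rate L T j.+1.
Proof.
have r0 : 0 <= rate L T j by rewrite mulr_ge0 ?exprn_ge0 ?powR_ge0.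
rewrite rateS mulrC ler_wpM2l //.
by have := sqrt2_sqr; have := powR_ge0 (2%:R : R) (1 / 2%:R); nra.
Qed.

Lemma rate_mono L T j : rate L T j <= rate L T j.+1.
Proof.
have r0 : 0 <= rate L T j by rewrite mulr_ge0 ?exprn_ge0 ?powR_ge0.
by apply: le_trans (rate_growth L T j); lra.
Qed.

Lemma selection_combine (T L N : nat) (D : R) tape (fs : seq (feedback R L)) :
  selection combine (100 * L.+1) T N D tape fs =
  Some (inord (sel tape (weights_after D T fs) (depth L T))).
Proof.
rewrite /selection.
have [m [s0 [m_le r0 inv0]]] := runs_init N D tape (rateS L T)
  (rate_mono L T) (fun=> (0, false)) (mulr1 _) erefl erefl.
rewrite (exec_runs m_le r0).
have depthL := nlevels_le (rate L T) L.+1.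
have : ready D (floor_weight L) (2%:R `^ (1 / 2%:R)) (rate L T) tape
    (depth L T) (fun=> floor_weight L) s0.
  case: inv0 => cs _ hs _ [c8 _ c0]; split=> // i i_n.
  exact: hs (leq_trans i_n depthL).
rewrite /weights_after; elim: fs (fun=> _) s0 {m m_le r0 inv0} => [|f fs IH] w s.
  move=> [_ _ c0 _] /=; rewrite c0 insubT => [|h].
    by rewrite ltnS (leq_trans (sel_le _ _ _)).
  by congr Some; apply: val_inj; rewrite /= inordK.
move=> rs.
have [m [s' [m_le r' rs']]] := runs_round (rateS L T) f depthL rs.
by rewrite /= (exec_runs m_le r') (IH _ _ rs').
Qed.

End correctness.

(** * Expected cost over the thresholds *)

Section sampling.
Context {R : realType} {d : measure_display} {Omega : measurableType d}.
Variables (Q : probability Omega R) (U : nat -> Omega -> R).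
Hypothesis HU : uniform_source Q U.
Implicit Types (B : nat -> set R) (C : set R).

Definition box (n k : nat) B : set Omega :=
  [set w | forall i, (n <= i < k)%N -> B i (U i w)].

Lemma measurable_box n k B : (forall i, measurable (B i)) ->
  measurable (box n k B).
Proof.
move=> mB; have [mU _ _] := HU.
rewrite (_ : box n k B =
    \bigcap_(i in [set i | (n <= i < k)%N]) (U i @^-1` B i)).
  apply: fin_bigcap_measurable.
    by apply: (sub_finite_set _ (finite_II k)) => i /= /andP[].
  by move=> i _; rewrite -[X in measurable X]setTI; exact: mU.
by apply/seteqP; split.
Qed.

Lemma Q_box n k B : (forall i, measurable (B i)) -> (n <= k)%N ->
  Q (box n k B) =
  (\prod_(n <= i < k) lebesgue_measure (B i `&` `[0%R, 1%R]))%E.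
Proof.
move=> mB nk; have [_ _ H] := HU.
(* The source describes initial segments of the samples; the positions below [n] are filled with the
   whole line, which contributes factors 1. *)
pose B' i := if (n <= i)%N then B i else setT.
have := H k (fun i => B' i); rewrite (_ : [set w | _] = box n k B); last first.
  apply/seteqP; split=> w /= h.
    by move=> i /andP[ni ik]; have := h (Ordinal ik); rewrite /B' /= ni.
  by move=> i; rewrite /B'; case: ifP => // ni; apply: h; rewrite ni ltn_ord.
move=> ->; last by move=> i; rewrite /B'; case: ifP.
rewrite -(big_mkord xpredT (fun i => lebesgue_measure (B' i `&` `[0%R, 1%R]))%E).
rewrite (big_cat_nat _ nk) //= [X in (X * _)%E]big1_seq ?mul1e; last first.
  move=> i /andP[_]; rewrite mem_index_iota /B' => /andP[_ i_n].
  by rewrite leqNgt i_n /= setTI lebesgue_measure_itv /= lte01 oppr0 adde0.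
by apply: eq_big_nat => i /andP[ni _]; rewrite /B' ni.
Qed.

Lemma Q_box_recl n k B C q : (forall i, measurable (B i)) -> measurable C ->
  (n < k)%N -> lebesgue_measure (C `&` `[0%R, 1%R]) = q%:E ->
  Q (U n @^-1` C `&` box n.+1 k B) = (q%:E * Q (box n.+1 k B))%E.
Proof.
move=> mB mC nk hq; pose B' i := if i == n then C else B i.
have mB' i : measurable (B' i) by rewrite /B'; case: ifP.
rewrite (_ : _ `&` _ = box n k B').
  rewrite !Q_box // 1?ltnW // big_ltn // {1}/B' eqxx hq; congr (_ * _)%E.
  by apply: eq_big_nat => i /andP[ni _]; rewrite /B' gtn_eqF.
apply/seteqP; split=> w /=.
  move=> [hC hB] i /andP[ni ik]; rewrite /B'; case: eqVneq => [->//|i_n].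
  by apply: hB; rewrite ik andbT ltn_neqAle eq_sym i_n.
move=> h; split; first by have := h n; rewrite leqnn nk /B' eqxx; exact.
move=> i /andP[ni ik]; have := h i; rewrite (ltnW ni) ik /B' gtn_eqF //; exact.
Qed.

Lemma measurable_le_set (x : R) : measurable [set y : R | y <= x].
Proof.
by rewrite (_ : [set _ | _] = `]-oo, x]%classic) //; apply/seteqP; split=> y;
   rewrite /= in_itv.
Qed.

Lemma uniform_le (x : R) : 0 <= x -> x <= 1 ->
  lebesgue_measure ([set y : R | y <= x] `&` `[0%R, 1%R]) = x%:E.
Proof.
move=> x0 x1; rewrite (_ : _ `&` _ = `[0, x]%classic).
  rewrite lebesgue_measure_itv /= lte_fin; case: ltP => [_|h].
    by rewrite oppr0 adde0.
  by congr EFin; apply/eqP; rewrite eq_le x0 h.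
apply/seteqP; split=> y /=; rewrite !in_itv /=.
  by move=> [yx /andP[-> _]].
by move=> /andP[-> yx]; rewrite yx (le_trans yx).
Qed.

Lemma uniform_gt (x : R) : 0 <= x -> x <= 1 ->
  lebesgue_measure (~` [set y : R | y <= x] `&` `[0%R, 1%R]) = (1 - x)%:E.
Proof.
move=> x0 x1; rewrite (_ : _ `&` _ = `]x, 1]%classic).
  rewrite lebesgue_measure_itv /= lte_fin; case: ltP => [_|h]; first by [].
  by congr EFin; lra.
apply/seteqP; split=> y /=; rewrite !in_itv /=.
  by move=> [/negP yx /andP[_ ->]]; rewrite ltNge yx.
move=> /andP[xy ->]; rewrite (le_trans x0 (ltW xy)); split=> //.
by apply/negP; rewrite -ltNge.
Qed.

Lemma uniform_between (x z : R) : 0 <= x -> x <= 1 -> 0 <= z -> z <= 1 ->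
  lebesgue_measure ([set y : R | (y <= x) != (y <= z)] `&` `[0%R, 1%R]) =
  `|z - x|%:E.
Proof.
wlog xz : x z / x <= z => [H|].
  move=> x0 x1 z0 z1; have [xz|/ltW zx] := leP x z; first exact: H.
  rewrite distrC -H //; congr (lebesgue_measure (_ `&` _)).
  by apply/seteqP; split=> y /=; rewrite eq_sym.
move=> x0 x1 z0 z1; rewrite (_ : _ `&` _ = `]x, z]%classic).
  rewrite lebesgue_measure_itv /= lte_fin ger0_norm ?subr_ge0 //.
  by case: ltP => [//|h]; congr EFin; lra.
apply/seteqP; split=> y /=; rewrite !in_itv /=.
  by case: (leP y x) => yx; case: (leP y z) => yz [] //=; lra.
move=> /andP[xy yz]; rewrite yz leNgt xy; split=> //.
by apply/andP; split; lra.
Qed.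

Lemma measurable_below (w : nat -> R) n :
  measurable_fun setT (fun o => U n o <= w n).
Proof. by have [mU _ _] := HU; exact: measurable_fun_ler. Qed.

Lemma measurable_sel2 (v w : nat -> R) n (F : nat -> nat -> R) :
  measurable_fun setT (fun o => F (sel (U ^~ o) v n) (sel (U ^~ o) w n)).
Proof.
elim: n F => [|n IH] F /=; first exact: measurable_cst.
pose G o := if U n o <= v n
  then (if U n o <= w n then F n.+1 n.+1 else F n.+1 (sel (U ^~ o) w n))
  else (if U n o <= w n then F (sel (U ^~ o) v n) n.+1
        else F (sel (U ^~ o) v n) (sel (U ^~ o) w n)).
rewrite (_ : (fun _ => _) = G); last first.
  by apply/funext => o; rewrite /G; case: ifP; case: ifP.
apply: measurable_fun_ifT; first exact: measurable_below.
  apply: measurable_fun_ifT; [exact: measurable_below|exact: measurable_cst|].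
  exact: IH (fun _ y => F n.+1 y).
apply: measurable_fun_ifT; [exact: measurable_below| |exact: IH].
exact: IH (fun x _ => F x n.+1).
Qed.

(** This is [mix] with the next weights as a parameter [v], which separates the sampling argument
    from the update rule. *)
Fixpoint mixture (w v a : nat -> R) j : R :=
  if j is i.+1 then
    let m := mixture w v a i in m - w i * (m - a i.+1) + `|v i - w i|
  else a 0.

Definition sel_cost (w v a : nat -> R) n (o : Omega) : R :=
  a (sel (U ^~ o) w n) + (sel (U ^~ o) v n != sel (U ^~ o) w n)%:R.

Section expectation.
Variables (w v a : nat -> R).
Hypotheses (w01 : forall i, 0 <= w i <= 1) (v01 : forall i, 0 <= v i <= 1)
  (a_ge0 : forall i, 0 <= a i).

Lemma mixture_ge0 n : 0 <= mixture w v a n.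
Proof.
elim: n => [|n IH] /=; first exact: a_ge0.
have /andP[w0 w1] := w01 n; rewrite addr_ge0 //.
have -> (x y z : R) : x - y * (x - z) = (1 - y) * x + y * z by ring.
by rewrite addr_ge0 ?mulr_ge0 // subr_ge0.
Qed.

Lemma sel_cost_ge0 n o : 0 <= sel_cost w v a n o.
Proof. by rewrite addr_ge0. Qed.

Lemma measurable_sel_cost n : measurable_fun setT (sel_cost w v a n).
Proof. exact: measurable_sel2 (fun x y => a y + (x != y)%:R). Qed.

(** Level [n] changes its mind exactly when its threshold separates [w n] from [v n]. Strictness can
    occur only when it takes over while the lower selection changes as well: the right side then
    charges two switches. *)
Lemma sel_costS_le n o : sel_cost w v a n.+1 o <=
  a n.+1 * \1_(U n @^-1` [set y | y <= w n]) o
  + \1_(U n @^-1` [set y | (y <= w n) != (y <= v n)]) o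
  + sel_cost w v a n o * \1_(U n @^-1` (~` [set y | y <= w n])) o.
Proof.
have indicb (b : pred R) : \1_(U n @^-1` [set y | b y]) o = (b (U n o))%:R :> R.
  by rewrite indicE; congr ((nat_of_bool _)%:R); apply/idP/idP; rewrite inE.
have -> : ~` [set y | y <= w n] = [set y | ~~ (y <= w n)].
  by apply/seteqP; split=> y /= /negP.
have a0 := a_ge0 (sel (U ^~ o) w n); have an := a_ge0 n.+1.
rewrite /sel_cost !indicb /=.
case: (U n o <= w n); case: (U n o <= v n) => /=.
- by rewrite eqxx /=; lra.
- by case: (sel _ v n == _) => /=; lra.
- by case: (sel _ v n == _); case: (n.+1 == _) => /=; lra.
- by case: (sel _ v n == _) => /=; lra.
Qed.

(* [box n k B] only constrains the samples of the levels from [n] on, so that it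
   is independent of the selection among the first [n] levels. *)
Lemma integral_sel_cost_box n k B : (n <= k)%N -> (forall i, measurable (B i)) ->
  (\int[Q]_(o in box n k B) (sel_cost w v a n o)%:E <=
   (mixture w v a n)%:E * Q (box n k B))%E.
Proof.
elim: n B => [|n IH] B nk mB.
  have mG0 := measurable_box 0 k mB.
  rewrite (eq_integral (cst (a 0)%:E)) ?integral_cst //.
  by move=> o _; rewrite /sel_cost /= addr0.
have mG := measurable_box n.+1 k mB.
have /andP[w0 w1] := w01 n; have /andP[v0 v1] := v01 n.
have [mU _ _] := HU.
have mC1 := measurable_le_set (w n).
have mC2 : measurable [set y : R | (y <= w n) != (y <= v n)].
  rewrite (_ : [set _ | _] = ([set y | y <= w n] `\` [set y | y <= v n]) `|`
      ([set y | y <= v n] `\` [set y | y <= w n])).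
    by apply: measurableU; apply: measurableD; exact: measurable_le_set.
  apply/seteqP; split=> y /=.
    by case: (y <= w n); case: (y <= v n) => //= _; [left|right].
  by move=> [[-> /negP/negbTE ->]|[-> /negP/negbTE ->]].
have mC3 := measurableC mC1.
set C1 := [set y | y <= w n] in mC1 mC3 *.
set C2 := [set y | _ != _] in mC2 *.
have mpre C : measurable C -> measurable (U n @^-1` C).
  by move=> mC; rewrite -[X in measurable X]setTI; exact: mU.
have m1 := mpre _ mC1; have m2 := mpre _ mC2; have m3 := mpre _ mC3.
have q1 : lebesgue_measure (C1 `&` `[0%R, 1%R]) = (w n)%:E by exact: uniform_le.
have q2 : lebesgue_measure (C2 `&` `[0%R, 1%R]) = `|v n - w n|%:E.
  exact: uniform_between.
have q3 : lebesgue_measure (~` C1 `&` `[0%R, 1%R]) = (1 - w n)%:E.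
  exact: uniform_gt.
have mX := measurable_sel_cost n.
have mf (f : Omega -> R) : measurable_fun setT f ->
    measurable_fun (box n.+1 k B) (EFin \o f).
  by move=> ?; apply/measurable_EFinP; exact: measurable_funTS.
have mi A : measurable A -> measurable_fun setT (\1_A : Omega -> R).
  by move=> mA; exact: measurable_indic.
pose f1 o : R := a n.+1 * \1_(U n @^-1` C1) o.
pose f2 o : R := \1_(U n @^-1` C2) o.
pose f3 o : R := sel_cost w v a n o * \1_(U n @^-1` (~` C1)) o.
have mf1 : measurable_fun setT f1 by apply: measurable_funM => //; exact: mi.
have mf2 : measurable_fun setT f2 by exact: mi.
have mf3 : measurable_fun setT f3 by apply: measurable_funM => //; exact: mi.
have f1_ge0 o : 0 <= f1 o by rewrite mulr_ge0.
have f3_ge0 o : 0 <= f3 o by rewrite mulr_ge0 ?sel_cost_ge0.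
apply: (@le_trans _ _
    (\int[Q]_(o in box n.+1 k B) ((f1 o)%:E + (f2 o)%:E + (f3 o)%:E))%E).
  apply: ge0_le_integral => //.
  - by move=> o _; rewrite lee_fin sel_cost_ge0.
  - exact: mf (measurable_sel_cost n.+1).
  - by apply: emeasurable_funD; [apply: emeasurable_funD|]; exact: mf.
  - by move=> o _; rewrite -!EFinD lee_fin sel_costS_le.
have mE1 := mf _ mf1; have mE2 := mf _ mf2; have mE3 := mf _ mf3.
have mE12 := emeasurable_funD mE1 mE2.
have h1 o : box n.+1 k B o -> (0 <= (EFin \o f1) o)%E by rewrite lee_fin.
have h2 o : box n.+1 k B o -> (0 <= (EFin \o f2) o)%E by rewrite lee_fin.
have h3 o : box n.+1 k B o -> (0 <= (EFin \o f3) o)%E by rewrite lee_fin.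
have h12 o : box n.+1 k B o -> (0 <= ((EFin \o f1) \+ (EFin \o f2)) o)%E.
  by move=> ?; rewrite adde_ge0 ?h1 ?h2.
rewrite (ge0_integralD _ mG h12 mE12 h3 mE3) (ge0_integralD _ mG h1 mE1 h2 mE2).
have i1 : (\int[Q]_(o in box n.+1 k B) (f1 o)%:E =
    (a n.+1 * w n)%:E * Q (box n.+1 k B))%E.
  under eq_integral do rewrite EFinM.
  have h o : box n.+1 k B o -> (0 <= (\1_(U n @^-1` C1) o : R)%:E)%E.
    by rewrite lee_fin.
  rewrite (ge0_integralZl _ mG (mf _ (mi _ m1)) h) ?lee_fin //.
  by rewrite integral_indic // [X in (_ * X)%E](Q_box_recl mB mC1 nk q1) muleA.
have i2 : (\int[Q]_(o in box n.+1 k B) (f2 o)%:E =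
    `|v n - w n|%:E * Q (box n.+1 k B))%E.
  by rewrite integral_indic //; exact: Q_box_recl mB mC2 nk q2.
have le3 : (\int[Q]_(o in box n.+1 k B) (f3 o)%:E <=
    (mixture w v a n * (1 - w n))%:E * Q (box n.+1 k B))%E.
  have -> : (\int[Q]_(o in box n.+1 k B) (f3 o)%:E =
     \int[Q]_(o in box n.+1 k B `&` (U n @^-1` (~` C1))) (sel_cost w v a n o)%:E)%E.
    rewrite integral_mkcondr; apply: eq_integral => o _.
    by rewrite /f3 patchE indicE; case: ifP => _; rewrite ?mulr1 ?mulr0.
  (* The event that level [n] stays below is turned into a constraint on sample [n], so the
     induction hypothesis applies to a box with one more constrained level. *)
  pose B' i := if i == n then ~` C1 else B i.
  have mB' i : measurable (B' i) by rewrite /B'; case: ifP.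
  have eB : box n.+1 k B `&` (U n @^-1` (~` C1)) = box n k B'.
    apply/seteqP; split=> o.
      move=> [hB hC] i /andP[ni ik]; rewrite /B'; case: eqVneq => [->//|i_n].
      by apply: hB; rewrite ik andbT ltn_neqAle eq_sym i_n.
    move=> h; split; last by have := h n; rewrite leqnn nk /B' eqxx; exact.
    move=> i /andP[ni ik]; have := h i; rewrite (ltnW ni) ik /B' gtn_eqF //; exact.
  rewrite eB; apply: le_trans (IH _ (ltnW nk) mB') _.
  by rewrite -eB setIC (Q_box_recl mB mC3 nk q3) EFinM muleA.
have em : mixture w v a n.+1 =
  a n.+1 * w n + `|v n - w n| + mixture w v a n * (1 - w n) by rewrite /=; ring.
apply: (@le_trans _ _ ((mixture w v a n.+1)%:E * Q (box n.+1 k B))%E); last by [].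
rewrite em.
rewrite !EFinD !ge0_muleDl ?lee_fin ?mulr_ge0 ?mixture_ge0 ?subr_ge0 //.
  by apply: leeD le3; rewrite -i1 -i2.
by rewrite addr_ge0 ?mulr_ge0.
Qed.

Lemma integral_sel_cost n :
  (\int[Q]_o (sel_cost w v a n o)%:E <= (mixture w v a n)%:E)%E.
Proof.
have := @integral_sel_cost_box n n (fun=> setT) (leqnn n) (fun=> measurableT).
have -> : box n n (fun=> setT) = setT.
  by apply/seteqP; split=> // o _ i; rewrite leqNgt; case: ltnP.
by rewrite probability_setT mule1.
Qed.

End expectation.
End sampling.

(** * The combined algorithm *)

Section costs.
Context {R : realType} {N : nat}.

Lemma measurable_fiber2 d (X : measurableType d) (f g : X -> 'I_N)
    (F : 'I_N -> 'I_N -> R) :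
  (forall i, measurable [set x | f x = i]) ->
  (forall i, measurable [set x | g x = i]) ->
  measurable_fun setT (fun x => F (f x) (g x)).
Proof.
move=> mf mg; pose A i := [set x | f x = i]; pose B i := [set x | g x = i].
have -> : (fun x => F (f x) (g x)) =
    (fun x => \sum_i \sum_j F i j * (\1_(A i) x * \1_(B j) x)).
  apply/funext => x; rewrite (bigD1 (f x)) //= (bigD1 (g x)) //= !indicE.
  rewrite !mem_set // !mulr1 !big1 ?addr0 // => [i fi|j gj].
    rewrite big1 // => j _; rewrite !indicE memNset ?mul0r ?mulr0 // /A /=.
    by apply/eqP; rewrite eq_sym.
  rewrite ?indicE (@memNset _ (B j)) ?mulr0 // /B /=.
  by apply/eqP; rewrite eq_sym.
apply: measurable_sum => i; apply: measurable_sum => j.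
apply: measurable_funM; first exact: measurable_cst.
by apply: measurable_funM; apply: measurable_indic; [exact: mf|exact: mg].
Qed.

Section one_algorithm.
Variables (T : nat) (D : R) (d : measure_display) (Om : measurableType d).
Variables (B : algorithm R N T Om) (l : nat -> loss R N).
Hypotheses (D_ge0 : 0 <= D) (legal : forall t, legal_loss (l t)).

Lemma legal_mkseq t : legal_history (mkseq l t).
Proof. by move=> s; rewrite size_mkseq => st; rewrite nth_mkseq. Qed.

Lemma measurable_action t i : (t < T)%N ->
  measurable [set w | action B l t w = i].
Proof.
by move=> tT; apply: measurable_act; rewrite ?size_mkseq //; exact: legal_mkseq.
Qed.

Lemma interval_cost_ge0 t0 k w : 0 <= interval_cost D B l t0 k w.
Proof.
rewrite addr_ge0 ?mulr_ge0 ?sumr_ge0 // => t _.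
by have /andP[] := legal t (action B l t w).
Qed.

Lemma interval_cost_le t0 k w : interval_cost D B l t0 k w <= (1 + D) * k%:R.
Proof.
rewrite mulrDl mul1r lerD //.
  apply: (@le_trans _ _ (\sum_(t0 <= t < t0 + k) 1)).
    by apply: ler_sum => t _; have /andP[] := legal t (action B l t w).
  by rewrite big_const_nat iter_addr_0 addKn.
rewrite ler_wpM2l //.
apply: (@le_trans _ _ (\sum_(t0.+1 <= t < t0 + k) 1)).
  by apply: ler_sum => t _; case: (_ != _).
by rewrite big_const_nat iter_addr_0 ler_nat; lia.
Qed.

Lemma measurable_interval_cost t0 k : (t0 + k <= T)%N ->
  measurable_fun setT (interval_cost D B l t0 k).
Proof.
(* Actions are known to be measurable only before the horizon, so the summands are truncated there
   to be measurable for every [t]. *)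
move=> kT; pose f t w := if (t < T)%N then l t (action B l t w) else 0.
pose g t w : R :=
  if (t < T)%N then (action B l t w != action B l t.-1 w)%:R else 0.
rewrite (_ : interval_cost D B l t0 k = (fun w =>
    \sum_(t0 <= t < t0 + k) f t w + D * \sum_(t0.+1 <= t < t0 + k) g t w)).
  apply: measurable_funD; first apply: measurable_sum => t.
    rewrite /f; case: ltnP => tT; last exact: measurable_cst.
    by apply: (@measurable_fiber2 _ _ _ (action B l t) (fun i _ => l t i)) => i;
       exact: measurable_action.
  apply: measurable_funM; first exact: measurable_cst.
  apply: measurable_sum => t; rewrite /g; case: ltnP => tT; last exact: measurable_cst.
  apply: (measurable_fiber2 (fun i j => (i != j)%:R)) => i.
    exact: measurable_action.
  by apply: measurable_action; rewrite (leq_ltn_trans (leq_pred _)).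
apply/funext => w; rewrite /interval_cost.
by congr (_ + _ * _); apply: eq_big_nat => t /andP[_ tk]; rewrite /f /g (leq_trans tk).
Qed.

Lemma expected_cost_ge0 (P : probability Om R) t0 k :
  (0 <= expected_cost D P B l t0 k)%E.
Proof. by apply: integral_ge0 => w _; rewrite lee_fin interval_cost_ge0. Qed.

End one_algorithm.

(** By Tonelli it suffices to compare costs for each fixed outcome of the inputs. Were the cost of
    [B] infinite, the difference would be [-oo]. *)
Lemma regret_product_le T D d (Om : measurableType d) (P : probability Om R)
    d' (Om' : measurableType d') (Q : probability Om' R)
    (A : algorithm R N T (Om * Om')%type) (B : algorithm R N T Om) t0 k c :
  0 <= D -> 0 <= c -> (t0 + k <= T)%N ->
  (forall l w, (forall t, legal_loss (l t)) ->
    (\int[Q]_w' (interval_cost D A l t0 k (w, w'))%:E <=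
     (interval_cost D B l t0 k w + c)%:E)%E) ->
  (regret D (P \x Q) A P B t0 k <= c%:E)%E.
Proof.
move=> D0 c0 kT H; apply: ge_ereal_sup => _ [l legal <-].
have le : (expected_cost D (P \x Q) A l t0 k <=
    expected_cost D P B l t0 k + c%:E)%E.
  rewrite /expected_cost (fubini_tonelli1 (EFin \o interval_cost D A l t0 k)).
  - apply: (@le_trans _ _ (\int[P]_w ((interval_cost D B l t0 k w)%:E + c%:E))%E).
      apply: ge0_le_integral => //.
      + by move=> w _; apply: integral_ge0 => w' _; rewrite lee_fin interval_cost_ge0.
      + apply: measurable_fun_fubini_tonelli_F.
          by apply/measurable_EFinP; exact: measurable_interval_cost.
        by move=> w; rewrite lee_fin interval_cost_ge0.
      + apply: emeasurable_funD; last exact: measurable_cst.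
        by apply/measurable_EFinP; exact: measurable_interval_cost.
      + by move=> w _; exact: H.
    rewrite ge0_integralD //.
    + by rewrite integral_cst // [X in (_ * X)%E]probability_setT mule1.
    + by move=> w _; rewrite lee_fin interval_cost_ge0.
    + by apply/measurable_EFinP; exact: measurable_interval_cost.
  - by apply/measurable_EFinP; exact: measurable_interval_cost.
  - by move=> w; rewrite lee_fin interval_cost_ge0.
have := expected_cost_ge0 B D0 legal P t0 k.
move: le; case: (expected_cost D P B l t0 k) => [r| |] //.
  by move=> h _; rewrite leeBlDr //; apply: le_trans h _; rewrite addeC.
by move=> _ _; rewrite /= addeNy leNye.
Qed.

End costs.

(** * The combined algorithm and its cost for a fixed outcome of the inputs *)

Section combination.
Context {R : realType} {N T L : nat} {d : measure_display}
  {Omega : measurableType d} {d' : measure_display} {Omega' : measurableType d'}.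
Variables (Abase : algorithm R N T Omega) (A_ : 'I_L.+1 -> algorithm R N T Omega).
Variables (Q : probability Omega' R) (U : nat -> Omega' -> R) (D : R).
Hypotheses (HU : uniform_source Q U) (D_ge1 : 1 <= D).
Local Notation input := (input_algorithm Abase A_).
Local Notation J := (@depth R L T).

Definition combined_act (h : seq (loss R N)) (w : Omega * Omega') : 'I_N :=
  input (inord (sel (U ^~ w.2) (weights_after D T (feedbacks Abase A_ h w.1)) J))
    h w.1.

(** For fixed [h] the outcome of the inputs matters only through the finite table [prof] of their
    actions on all prefixes of [h], so the event is a finite union of rectangles. *)
Lemma measurable_combined_act h : (size h < T)%N -> legal_history h ->
  forall i, measurable [set w | combined_act h w = i].
Proof.
move=> hT hlegal i; pose n := size h.
pose prof w : {ffun 'I_n.+1 * 'I_L.+2 -> 'I_N} :=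
  [ffun p : 'I_n.+1 * 'I_L.+2 => input p.2 (take p.1 h) w].
pose fb (p : {ffun 'I_n.+1 * 'I_L.+2 -> 'I_N}) t : feedback R L :=
  fun a => (nth (fun=> 0) h t (p (inord t, a)),
            (0 < t)%N && (p (inord t, a) != p (inord t.-1, a))).
pose choice (p : {ffun 'I_n.+1 * 'I_L.+2 -> 'I_N}) w' : 'I_N :=
  p (ord_max, inord (sel (U ^~ w') (weights_after D T (mkseq (fb p) n)) J)).
have actE w : combined_act h w = choice (prof w.1) w.2.
  rewrite /combined_act /choice ffunE /= take_size.
  congr (input (inord (sel _ (weights_after D T _) _)) _ _).
  apply: (@eq_from_nth _ (fun=> (0, false))); first by rewrite !size_mkseq.
  move=> t; rewrite size_mkseq => tn; rewrite !nth_mkseq //.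
  apply/funext => a; rewrite /feedback_at /fb !ffunE /= !inordK //.
  - by rewrite ltnS (leq_trans (leq_pred _)) // ltnW.
  - by rewrite ltnS ltnW.
rewrite (_ : [set w | _] = \big[setU/set0]_(p : {ffun 'I_n.+1 * 'I_L.+2 -> 'I_N})
    ([set w | prof w = p] `*` [set w' | choice p w' = i])); last first.
  apply/seteqP; split=> w.
    rewrite /= actE => <-; rewrite -bigcup_seq; exists (prof w.1) => //=.
    by rewrite mem_index_enum.
  by rewrite -bigcup_seq => -[p _ /= [<- <-]]; rewrite actE.
apply: bigsetU_measurable => p _; apply: measurableX.
  rewrite (_ : [set w | _] = \big[setI/setT]_(q : 'I_n.+1 * 'I_L.+2)
      [set w | input q.2 (take q.1 h) w = p q]); last first.
    apply/seteqP; split=> w; rewrite -bigcap_seq /=.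
      by move=> <- q _ /=; rewrite ffunE.
    by move=> H; apply/ffunP => q; rewrite ffunE; apply: H; rewrite /= mem_index_enum.
  apply: bigsetI_measurable => q _; apply: measurable_act.
    by apply: leq_ltn_trans hT; rewrite size_take_min geq_minr.
  move=> t; rewrite size_take_min leq_min => /andP[tq th].
  by rewrite nth_take //; exact: hlegal.
pose w := weights_after D T (mkseq (fb p) n).
pose F (_ x : nat) : R := (p (ord_max, inord x) == i)%:R.
have := measurable_sel2 HU w w J F measurableT (measurable_set1 1).
rewrite setTI; congr measurable; apply/seteqP; split=> w' /=.
  by rewrite /F; case: eqP => //= _ /esym/eqP; rewrite oner_eq0.
by rewrite /F /choice -/w => ->; rewrite eqxx.
Qed.

Definition combined : algorithm R N T (Omega * Omega')%type :=
  Algorithm measurable_combined_act.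

Lemma combined_by_combine :
  combined_by Abase A_ combine (100 * L.+1) D U combined.
Proof. by move=> h w _ _; eexists; [exact: selection_combine|]. Qed.

Variable l : nat -> loss R N.
Hypothesis legal : forall t, legal_loss (l t).

Definition stream_feedback (w : Omega) (t : nat) : feedback R L := fun a =>
  (l t (action (input a) l t w),
   (0 < t)%N && (action (input a) l t w != action (input a) l t.-1 w)).

Lemma feedbacks_mkseq w t :
  feedbacks Abase A_ (mkseq l t) w = mkseq (stream_feedback w) t.
Proof.
apply: (@eq_from_nth _ (fun=> (0, false))); first by rewrite !size_mkseq.
move=> s; rewrite !size_mkseq => st; rewrite !nth_mkseq ?size_mkseq //.
have take_mkseq r : (r < t)%N -> take r (mkseq l t) = mkseq l r.
  by move=> rt; rewrite /mkseq -map_take take_iota (minn_idPl (ltnW rt)).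
apply/funext => a; rewrite /feedback_at /stream_feedback nth_mkseq //.
by rewrite !take_mkseq // (leq_ltn_trans (leq_pred _)).
Qed.

Local Notation cost w := (fun t => input_cost D (stream_feedback w t)).
Local Notation W w := (weights (floor_weight L) (rate L T) (cost w)).

Lemma cost_range w t i : 0 <= cost w t i <= 2.
Proof.
have D0 : 0 < D by exact: lt_le_trans D_ge1.
rewrite /input_cost /=; set x := l t _; set b := (0 < t)%N && _.
have /andP[x0 x1] : 0 <= x <= 1 by exact: legal.
have h1 : x / D <= 1 by rewrite ler_pdivrMr ?mul1r // (le_trans x1).
have h0 : 0 <= x / D by rewrite divr_ge0 // ltW.
rewrite addr_ge0 //= (_ : 2 = 1 + 1) // lerD //.
by case: b.
Qed.

Lemma weights_after_stream w t :
  weights_after D T (mkseq (stream_feedback w) t) = W w t.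
Proof.
elim: t => [|t IH] //; rewrite mkseqS /weights_after foldl_rcons.
by rewrite -/(weights_after D T _) IH.
Qed.

Lemma action_combined t w w' : action combined l t (w, w') =
  action (input (inord (sel (U ^~ w') (W w t) J))) l t w.
Proof.
by rewrite /action /= /combined_act /= feedbacks_mkseq weights_after_stream.
Qed.

(** A switch of the action comes from a change of the selection or from the followed input, whose
    switch is part of its cost. Selection changes are charged one round early; the charges that then
    lie outside the interval's own switches are nonnegative and only enlarge the right side. *)
Lemma combined_cost_le t0 k w w' :
  interval_cost D combined l t0 k (w, w') <=
  D * \sum_(t0 <= t < t0 + k) sel_cost U (W w t) (W w t.+1) (cost w t) J w'.
Proof.
have D0 : 0 < D by exact: lt_le_trans D_ge1.
pose s t := sel (U ^~ w') (W w t) J.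
pose sw t : R := (stream_feedback w t (inord (s t))).2%:R.
rewrite /interval_cost /sel_cost big_split /= mulrDr.
rewrite [X in _ <= X + _](_ : _ = \sum_(t0 <= t < t0 + k)
    l t (action combined l t (w, w')) + D * \sum_(t0 <= t < t0 + k) sw t).
  rewrite -addrA -mulrDr lerD2l ler_pM2l //.
  have step t : ((action combined l t.+1 (w, w') !=
      action combined l t (w, w'))%:R : R) <= sw t.+1 + (s t.+1 != s t)%:R.
    rewrite !action_combined -/(s t) -/(s t.+1) /sw /=.
    case: (eqVneq (s t.+1) (s t)) => [->|_]; first by rewrite addr0.
    by apply: (@le_trans _ _ 1); [rewrite lern1 leq_b1|rewrite lerDr ler0n].
  rewrite big_add1; apply: (@le_trans _ _ (\sum_(t0 <= t < (t0 + k).-1)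
      (sw t.+1 + (s t.+1 != s t)%:R))); first by apply: ler_sum => t _; exact: step.
  rewrite big_split /=; case: k => [|k].
    by rewrite addn0 !big_geq ?leq_pred.
  rewrite addnS /=; apply: lerD.
    have -> : \sum_(t0 <= t < t0 + k) sw t.+1 =
        \sum_(t0.+1 <= t < (t0 + k).+1) sw t by rewrite big_add1.
    by rewrite [leRHS]big_ltn ?ltnS ?leq_addr // lerDr.
  by rewrite [leRHS]big_nat_recr ?leq_addr //= lerDl.
rewrite !mulr_sumr -big_split; apply: eq_bigr => t _.
rewrite action_combined /sw /input_cost /= mulrDr; congr (_ + _).
by rewrite mulrC divfK ?gt_eqF.
Qed.

Lemma combined_expected_cost_le t0 k w : (t0 + k <= T)%N ->
  (\int[Q]_w' (interval_cost D combined l t0 k (w, w'))%:E <=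
   (D * \sum_(t0 <= t < t0 + k)
      mix (floor_weight L) (rate L T) (W w t) (cost w t) J)%:E)%E.
Proof.
move=> kT; have D0 : 0 < D by exact: lt_le_trans D_ge1.
have g0 : 0 < floor_weight L :> R by exact: expR_gt0.
have g1 : floor_weight L <= 1 :> R.
  by rewrite -(expR0 R) ler_expR sub0r oppr_le0 mulr_ge0.
have W01 t i : 0 <= W w t i <= 1.
  have /andP[h h'] := weights_range (rate L T) g1 (cost w) t i.
  by rewrite h' (le_trans (ltW g0) h).
have a0 t i : 0 <= cost w t i by have /andP[] := cost_range w t i.
pose X t w' := sel_cost U (W w t) (W w t.+1) (cost w t) J w'.
have mX t : measurable_fun setT (X t) by exact: (measurable_sel_cost HU).
have X0 t w' : 0 <= X t w' by exact: sel_cost_ge0.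
apply: (@le_trans _ _
    (\int[Q]_w' (D%:E * \sum_(t0 <= t < t0 + k) (X t w')%:E))%E).
  apply: ge0_le_integral => //.
  - by move=> w' _; rewrite lee_fin interval_cost_ge0 // ltW.
  - apply/measurable_EFinP; apply: (measurableT_comp
      (measurable_interval_cost D combined legal kT)).
    exact: pair1_measurable.
  - apply: measurable_funeM; apply: emeasurable_sum => t.
    exact/measurable_EFinP.
  - by move=> w' _; rewrite sumEFin -EFinM lee_fin; exact: combined_cost_le.
rewrite ge0_integralZl ?lee_fin ?(ltW D0) //; last 2 first.
- by apply: emeasurable_sum => t; exact/measurable_EFinP.
- by move=> w' _; rewrite sumEFin lee_fin sumr_ge0.
rewrite EFinM lee_pmul2l ?lte_fin // ge0_integral_sum //; last 2 first.
- by move=> t; exact/measurable_EFinP.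
- by move=> t w' _; rewrite lee_fin.
rewrite -sumEFin; apply: lee_sum => t _.
apply: le_trans (integral_sel_cost HU (W01 t) (W01 t.+1) (a0 t) J) _.
have mixE n : mixture (W w t) (W w t.+1) (cost w t) n =
    mix (floor_weight L) (rate L T) (W w t) (cost w t) n.
  by elim: n => //= n ->.
by rewrite mixE.
Qed.

(** The extra [D] is the input's switch into the first step, reported by the feedback but free in
    [interval_cost]; at time 0 there is none. *)
Lemma input_cost_sum_le t0 k (i : 'I_L.+2) w :
  D * \sum_(t0 <= t < t0 + k) cost w t i <=
  interval_cost D (input i) l t0 k w + (0 < t0)%:R * D.
Proof.
have D0 : 0 < D by exact: lt_le_trans D_ge1.
rewrite /interval_cost -addrA mulr_sumr.
rewrite (eq_bigr (fun t => l t (action (input i) l t w) +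
    D * (stream_feedback w t i).2%:R)); last first.
  by move=> t _; rewrite /input_cost inord_val mulrDr mulrC divfK ?gt_eqF.
rewrite big_split /= -mulr_sumr lerD2l [_%:R * D]mulrC -mulrDr ler_pM2l //.
case: k => [|k]; first by rewrite addn0 !big_geq // add0r.
rewrite [leLHS]big_ltn ?addnS ?ltnS ?leq_addr // addrC lerD //.
  by apply: ler_sum_nat => t /andP[tt _]; rewrite (leq_ltn_trans _ tt).
by rewrite ler_nat; case: (0 < t0)%N => //=; exact: leq_b1.
Qed.

End combination.

(** * Choice of the constants and the theorem *)

Section constants.
Context {R : realType}.
Implicit Types (L T k u : nat).

Lemma inactive_rate (eta : nat -> R) n u :
  (nlevels eta n <= u)%N -> (u < n)%N -> 1 / 64 < eta u.
Proof.
elim: n => //= n IH h; rewrite ltnS => un; move: h; case: ifPn => [_|].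
  by rewrite ltnNge un.
rewrite -ltNge => etan h; move: un.
by rewrite leq_eqVlt => /predU1P[->//|]; exact: IH.
Qed.

Lemma rate_sqr L T j : rate L T j ^+ 2 = L%:R / T%:R * 2 ^+ j :> R.
Proof.
rewrite /rate exprMn div1r !powR12_sqrt ?divr_ge0 // sqr_sqrtr ?divr_ge0 //.
by rewrite exprAC sqr_sqrtr.
Qed.

Lemma rate_gt0 L T j : (0 < L)%N -> (0 < T)%N -> 0 < rate L T j :> R.
Proof.
by move=> L0 T0; rewrite mulr_gt0 ?exprn_gt0 ?powR_gt0 ?divr_gt0 ?ltr0n.
Qed.

Lemma floor_weight_le1 L : floor_weight L <= 1 :> R.
Proof. by rewrite -(expR0 R) ler_expR sub0r oppr_le0 mulr_ge0. Qed.

Lemma floor_weight_le L : floor_weight L * (2 ^ L)%:R ^+ 5 <= 1 :> R.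
Proof.
have e2 : 2 <= expR 1 :> R by have := expR_ge1Dx (1 : R); lra.
have : (2 ^ L)%:R ^+ 5 <= expR (5%:R * L%:R) :> R.
  rewrite -[in leRHS](mulr1 L%:R) mulrA -natrM expRM_natl natrX -exprM mulnC.
  by rewrite lerXn2r ?nnegrE ?expR_ge0.
rewrite /floor_weight sub0r expRN [_^-1 * _]mulrC => h.
by rewrite ler_pdivrMr ?expR_gt0 // mul1r.
Qed.

Lemma le_ln_pow2 L : L%:R <= 2 * ln (2 ^ L)%:R :> R.
Proof.
have ln2 : 1 / 2 <= ln (2 : R).
  by have := @ln_le_subr1 R 2^-1 ltac:(lra); rewrite lnV ?posrE //; lra.
rewrite natrX lnXn // -[ln _ *+ L]mulr_natl mulrCA -[leLHS]mulr1 ler_wpM2l //.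
lra.
Qed.

Section interval.
Variables (L k u : nat).
Local Notation T := (2 ^ L)%N.
Local Notation eta := (rate L T u : R).
Hypotheses (L_gt0 : (0 < L)%N) (k_ge : T%:R / 2 ^+ u.+1 <= k%:R :> R)
  (k_le : k%:R <= T%:R / 2 ^+ u :> R).
Let sigma : R := Num.sqrt (k%:R * L%:R).
Let theta : R := Num.sqrt (k%:R * ln T%:R).

Let T0 : 0 < T%:R :> R.
Proof. by rewrite ltr0n expn_gt0. Qed.

Let eta0 : 0 < eta.
Proof. by rewrite rate_gt0 ?expn_gt0. Qed.

(** This passes from the binary logarithm of the rates to the natural one of the claim, using
    [1 / 2 <= ln 2]. *)
Lemma sigma_le_theta : sigma <= 2 * theta.
Proof.
rewrite /sigma /theta.
have -> : 2 = Num.sqrt (2 ^+ 2) :> R by rewrite sqrtr_sqr ger0_norm.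
rewrite -sqrtrM ?sqr_ge0 // ler_wsqrtr // mulrCA ler_wpM2l //.
have := le_ln_pow2 L; have : 0 <= ln T%:R :> R.
  by rewrite ln_ge0 // ler1n expn_gt0.
lra.
Qed.

Let pow_u_gt0 : 0 < 2 ^+ u :> R.
Proof. by rewrite exprn_gt0. Qed.

(** The regret terms [k * eta] and [L / eta] balance at [eta = sqrt (L / k)], and [k] is comparable
    to [T / 2 ^ u]. Its upper bound serves here, its lower bound in [rate_inv_le]. *)
Lemma length_rate_le : k%:R * eta <= sigma.
Proof.
have h0 : 0 <= k%:R * eta by rewrite mulr_ge0 // ltW.
rewrite -(ger0_norm h0) -sqrtr_sqr ler_wsqrtr // exprMn rate_sqr.
have -> : k%:R ^+ 2 * (L%:R / T%:R * 2 ^+ u) =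
    k%:R * L%:R * (k%:R / (T%:R / 2 ^+ u)) :> R.
  by field; rewrite !gt_eqF.
by rewrite ler_piMr ?mulr_ge0 // ler_pdivrMr ?divr_gt0 // mul1r.
Qed.

Lemma rate_inv_le : L%:R * eta^-1 <= 2 * sigma.
Proof.
have h0 : 0 <= L%:R * eta^-1 by rewrite mulr_ge0 // invr_ge0 ltW.
rewrite -(ger0_norm h0) -sqrtr_sqr /sigma.
have -> : 2 = Num.sqrt (2 ^+ 2) :> R by rewrite sqrtr_sqr ger0_norm.
rewrite -sqrtrM ?sqr_ge0 // ler_wsqrtr // exprMn exprVn rate_sqr.
have -> : L%:R ^+ 2 * (L%:R / T%:R * 2 ^+ u)^-1 =
    L%:R * (2 * (T%:R / 2 ^+ u.+1)) :> R.
  rewrite [2 ^+ u.+1]exprS; field.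
  by rewrite !gt_eqF // ltr0n.
have L0 : 0 <= L%:R :> R by [].
have -> : 2 ^+ 2 * (k%:R * L%:R) = L%:R * (2 * (2 * k%:R)) :> R by ring.
rewrite ler_wpM2l // ler_wpM2l // (le_trans k_ge) // ler_peMl //.
by lra.
Qed.

Lemma sigma_ge1 : 1 <= sigma.
Proof.
have k0 : (0 < k)%N.
  rewrite -(ltr0n R); apply: lt_le_trans k_ge.
  by rewrite divr_gt0 // exprn_gt0.
rewrite -[leLHS](sqrtr1 R) ler_wsqrtr // -natrM ler1n muln_gt0 k0; exact: L_gt0.
Qed.

(** In units of [D], any algorithm costs at most [2 * k] on the interval, and
    [k / 64 <= sigma <= 2 * theta]. This case determines the constant 256. *)
Lemma inactive_bound : 1 / 64 < eta -> 2 * k%:R <= 256 * theta.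
Proof.
move=> h; have := length_rate_le; have := sigma_le_theta.
have : k%:R * (1 / 64) <= k%:R * eta by rewrite ler_wpM2l // ltW.
move: (k%:R * eta) => x; lra.
Qed.

(** The final [+ 1] is the free first switch of [A_u]. Everything adds up to at most
    [13 * L / eta + 65 * sigma <= 91 * sigma]. *)
Lemma active_bound :
  (1 - ln (floor_weight L)) / eta + 64 * k%:R * eta +
  (1 + k%:R * floor_weight L) * (7 / 2 * eta^-1) + 1 <= 256 * theta.
Proof.
have -> : ln (floor_weight L) = - (5 * L%:R) :> R by rewrite expRK sub0r.
have L1 : 1 <= L%:R :> R by rewrite ler1n.
have g0 : 0 < floor_weight L :> R by exact: expR_gt0.
have T1 : 1 <= T%:R :> R by rewrite ler1n expn_gt0.
have u1 : 1 <= 2 ^+ u :> R by rewrite exprn_ege1 //; lra.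
have kT : k%:R <= T%:R :> R.
  by apply: le_trans k_le _; rewrite ler_pdivrMr // ler_peMr.
have kg : k%:R * floor_weight L <= 1 :> R.
  apply: le_trans (floor_weight_le L); rewrite mulrC ler_wpM2l ?(ltW g0) //.
  by apply: le_trans kT _; rewrite exprS ler_peMr // exprn_ege1.
have e0 : 0 < eta^-1 by rewrite invr_gt0.
have h1 : (1 + k%:R * floor_weight L) * (7 / 2 * eta^-1) <= 2 * (7 / 2 * eta^-1).
  by rewrite ler_wpM2r ?mulr_ge0 ?(ltW e0) // -[2]/(1 + 1) lerD2l.
have h2 : eta^-1 <= L%:R * eta^-1 by rewrite ler_peMl // ltW.
have := length_rate_le; have := rate_inv_le; have := sigma_le_theta.
have := sigma_ge1; move: h1 h2; rewrite -[64 * _ * _]mulrA.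
move: (k%:R * eta) ((1 + _) * (7 / 2 * eta^-1)) => x y.
have -> : (1 - - (5 * L%:R)) / eta = eta^-1 + 5 * (L%:R * eta^-1) :> R by ring.
move: (L%:R * eta^-1) (eta^-1) => a b; lra.
Qed.

End interval.

(** Since [1 / eta_0 <= T], the left side is at most [7 * T ^ 2 * g]; from [T = 2] on this is below
    [T ^ 5 * g <= 1], which explains the 5 in the floor. *)
Lemma base_bound L : (0 < L)%N ->
  (1 + (2 ^ L)%:R) * floor_weight L * (7 / 2 * (rate L (2 ^ L) 0)^-1) <= 1 :> R.
Proof.
move=> L0; set T : R := (2 ^ L)%:R; set g : R := floor_weight L.
have T2 : 2 <= T by rewrite (ler_nat _ 2) -{1}(expn1 2) leq_pexp2l.
have T0 : 0 < T by lra.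
have e0 : 0 < rate L (2 ^ L) 0 :> R by rewrite rate_gt0 ?expn_gt0.
have inv : (rate L (2 ^ L) 0)^-1 <= T.
  rewrite -[leLHS]mul1r ler_pdivrMr //.
  have : (T * rate L (2 ^ L) 0) ^+ 2 = T * L%:R.
    by rewrite exprMn rate_sqr expr0; field; rewrite gt_eqF.
  have : 1 <= L%:R :> R by rewrite ler1n.
  have : 0 < T * rate L (2 ^ L) 0 by rewrite mulr_gt0.
  move: (T * _) (L%:R) => x y; rewrite expr2 => x0 y1 xx.
  by rewrite leNgt; apply/negP => x1; nra.
have g0 : 0 < g by exact: expR_gt0.
have gT : g * T ^+ 5 <= 1 by exact: floor_weight_le.
have T3 : 8 <= T ^+ 3.
  by rewrite (_ : 8 = 2 ^+ 3) ?lerXn2r ?nnegrE ?(ltW T0) //; lra.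
clearbody T g; apply: le_trans gT.
apply: (@le_trans _ _ ((2 * T) * g * (7 / 2 * T))).
  apply: ler_pM.
  - by rewrite mulr_ge0 ?(ltW g0) // addr_ge0 // ltW.
  - by rewrite mulr_ge0 // invr_ge0 ltW.
  - by rewrite ler_pM2r // mulrDl mul1r lerD2r; apply: le_trans T2; lra.
  - by rewrite ler_wpM2l.
have -> : 2 * T * g * (7 / 2 * T) = g * (7 * T ^+ 2) by field.
have -> : T ^+ 5 = T ^+ 3 * T ^+ 2 by ring.
by rewrite ler_pM2l // ler_pM2r ?exprn_gt0 //; apply: le_trans T3; lra.
Qed.

End constants.

(** * Regret of the combined algorithm *)

Section main.
Context {R : realType} {N L : nat} {d : measure_display}
  {Omega : measurableType d} {d' : measure_display} {Omega' : measurableType d'}.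
Local Notation T := (2 ^ L)%N.
Variables (P : probability Omega R) (Q : probability Omega' R).
Variables (Abase : algorithm R N T Omega) (A_ : 'I_L.+1 -> algorithm R N T Omega).
Variables (U : nat -> Omega' -> R) (D : R).
Hypotheses (HU : uniform_source Q U) (D_ge1 : 1 <= D).
Local Notation A := (combined Abase A_ D HU).

Let D0 : 0 < D.
Proof. exact: lt_le_trans D_ge1. Qed.

Lemma input_lift u : input_algorithm Abase A_ (lift ord0 u) = A_ u.
Proof. by rewrite /input_algorithm liftK. Qed.

Lemma input_base : input_algorithm Abase A_ ord0 = Abase.
Proof. by rewrite /input_algorithm unlift_none. Qed.

Lemma integral_le_cst (f : Omega' -> R) c : measurable_fun setT f ->
  (forall w, 0 <= f w <= c) -> (\int[Q]_w (f w)%:E <= c%:E)%E.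
Proof.
move=> mf fc; apply: (@le_trans _ _ (\int[Q]_w (cst c%:E w))%E).
  apply: ge0_le_integral => //.
  - by move=> w _; rewrite lee_fin; have /andP[] := fc w.
  - exact/measurable_EFinP.
  - by move=> w _; rewrite lee_fin; have /andP[] := fc w.
by rewrite integral_cst // [X in (_ * X)%E]probability_setT mule1.
Qed.

Lemma combined_cost_le_cst l w t0 k c : (forall t, legal_loss (l t)) ->
  (t0 + k <= T)%N -> (forall w', interval_cost D A l t0 k (w, w') <= c) ->
  (\int[Q]_w' (interval_cost D A l t0 k (w, w'))%:E <= c%:E)%E.
Proof.
move=> legal kT le_c; apply: integral_le_cst.
  apply: (measurableT_comp (measurable_interval_cost D A legal kT)).
  exact: pair1_measurable.
by move=> w'; rewrite le_c interval_cost_ge0 // ltW.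
Qed.

Lemma single_step_cost (B : algorithm R N T Omega) l w :
  interval_cost D B l 0 1 w = l 0 (action B l 0 w).
Proof. by rewrite /interval_cost add0n big_nat1 big_geq // mulr0 addr0. Qed.

Section single_step.
Hypothesis L0 : L = 0%N.

(** With [T = 1] the claimed bound to [A_0] is 0, so [A_0] must always be followed: the rate 0 makes
    its level active, and its weight is the floor 1, which no threshold exceeds. *)
Lemma action_combined_single l w w' :
  action A l 0 (w, w') = action (A_ ord0) l 0 w.
Proof.
rewrite action_combined /= -input_lift; congr (action (input_algorithm _ _ _) _ _ _).
have [_ /(_ w') Ule1 _] := HU.
have rate0 : rate L T 0 = 0 :> R.
  by rewrite /rate L0 mul0r powR0 ?mul0r // mulf_neq0 ?oner_neq0 ?invr_neq0.
have floor1 : floor_weight L = 1 :> R.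
  by rewrite /floor_weight L0 mulr0 subr0 expR0.
have -> : depth (R := R) L T = 1%N.
  rewrite /depth [in X in nlevels _ X]L0 /= rate0.
  by rewrite divr_ge0.
rewrite /= floor1; have /andP[_ ->] := Ule1 0%N.
by apply: val_inj; rewrite /= inordK.
Qed.

End single_step.

Lemma regret_challenger (u : 'I_L.+1) t0 k : (0 < L)%N -> (t0 + k <= T)%N ->
  T%:R / 2 ^+ u.+1 <= k%:R :> R -> k%:R <= T%:R / 2 ^+ u :> R ->
  (regret D (P \x Q) A P (A_ u) t0 k <=
   (256 * D * Num.sqrt (k%:R * ln T%:R))%:E)%E.
Proof.
move=> L0 kT k_ge k_le; set theta := Num.sqrt _.
have c0 : 0 <= 256 * D * theta by rewrite !mulr_ge0 ?sqrtr_ge0 // ltW.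
apply: regret_product_le => //; first exact: ltW.
move=> l w legal; have cu0 := interval_cost_ge0 (A_ u) (ltW D0) legal t0 k w.
have [uJ|Ju] := ltnP u (depth (R := R) L T); last first.
  apply: combined_cost_le_cst => // w'.
  apply: le_trans (interval_cost_le _ (ltW D0) legal _ _ _) _.
  have := inactive_bound L0 k_le (inactive_rate Ju (ltn_ord u)).
  rewrite -/theta => h; apply: (@le_trans _ _ (D * (2 * k%:R))).
    rewrite mulrA ler_wpM2r // mulrC (_ : 2 * D = D + D); last by ring.
    by rewrite lerD2r.
  apply: (@le_trans _ _ (256 * D * theta)); last by rewrite lerDr.
  by rewrite [256 * D]mulrC -mulrA ler_wpM2l // ltW.
apply: le_trans (combined_expected_cost_le Abase A_ HU D_ge1 legal w kT) _.
rewrite lee_fin; pose cost t := input_cost D (stream_feedback Abase A_ l w t).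
have cost02 t i : 0 <= cost t i <= 2 by exact: cost_range.
have h3 := @levels_regret_challenger R (floor_weight L) (rate L T) (expR_gt0 _)
  (floor_weight_le1 L) (depth L T)
  (fun j => @rate_gt0 R L T j L0 (expn_gt0 2 L))
  (fun j => @active_lt_nlevels R (rate L T) (rate_mono L T) L.+1 j)
  (rate_growth L T) cost cost02 t0 k u uJ.
have h1 := input_cost_sum_le Abase A_ D_ge1 l t0 k (lift ord0 u) w.
rewrite input_lift in h1.
have h2 := active_bound L0 k_ge k_le.
have h1' : D * \sum_(t0 <= t < t0 + k) cost t u.+1 <=
    interval_cost D (A_ u) l t0 k w + D.
  by apply: le_trans h1 _; rewrite lerD2l ler_piMl ?(ltW D0) // lern1 leq_b1.
apply: (@le_trans _ _ (D * (\sum_(t0 <= t < t0 + k) cost t u.+1 +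
    (256 * theta - 1)))).
  rewrite ler_pM2l //; apply: le_trans h3 _; rewrite -!addrA lerD2l.
  by rewrite lerBrDr -!addrA; move: h2; rewrite -!addrA.
have -> (x : R) : D * (x + (256 * theta - 1)) = D * x + (256 * D * theta - D).
  by ring.
have gen (a i c : R) : a <= i + D -> a + (c - D) <= i + c by lra.
exact: gen h1'.
Qed.

Lemma regret_base : (0 < L)%N ->
  (regret D (P \x Q) A P Abase 0 T <= D%:E)%E.
Proof.
move=> L0; apply: regret_product_le; rewrite ?ltW //.
move=> l w legal; have kT : (0 + T <= T)%N by [].
apply: le_trans (combined_expected_cost_le Abase A_ HU D_ge1 legal w kT) _.
rewrite lee_fin; pose cost t := input_cost D (stream_feedback Abase A_ l w t).
have cost02 t i : 0 <= cost t i <= 2 by exact: cost_range.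
have h3 := @levels_regret_base R (floor_weight L) (rate L T) (expR_gt0 _)
  (floor_weight_le1 L) (depth L T)
  (fun j => @rate_gt0 R L T j L0 (expn_gt0 2 L))
  (fun j => @active_lt_nlevels R (rate L T) (rate_mono L T) L.+1 j)
  (rate_growth L T) cost cost02 T.
have h1 := input_cost_sum_le Abase A_ D_ge1 l 0 T ord0 w.
rewrite input_base mul0r addr0 in h1.
rewrite add0n in h1 *.
have h2 : D * ((1 + T%:R) * floor_weight L * (7 / 2 * (rate L T 0)^-1)) <= D.
  by rewrite ger_pMr // base_bound.
apply: (@le_trans _ _ (D * (\sum_(0 <= t < T) cost t 0%N +
  (1 + T%:R) * floor_weight L * (7 / 2 * (rate L T 0)^-1)))).
  by rewrite ler_pM2l.
by rewrite mulrDr lerD.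
Qed.

Section single_step_regret.
Hypothesis L0 : L = 0%N.

Lemma regret_challenger_single t0 k : (t0 + k <= T)%N -> (0 < k)%N ->
  (regret D (P \x Q) A P (A_ ord0) t0 k <= 0)%E.
Proof.
move=> kT k0; have [-> ->] : t0 = 0%N /\ k = 1%N.
  by move: kT k0; rewrite L0 expn0; lia.
apply: regret_product_le => //; [exact: ltW|by rewrite L0|].
move=> l w legal; rewrite addr0; apply: combined_cost_le_cst => //.
  by rewrite L0.
move=> w'; rewrite single_step_cost /interval_cost add0n big_nat1 big_geq //.
by rewrite mulr0 addr0 action_combined_single.
Qed.

Lemma regret_base_single : (regret D (P \x Q) A P Abase 0 T <= D%:E)%E.
Proof.
rewrite [X in regret _ _ _ _ _ _ X](_ : _ = 1%N); last by rewrite L0.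
apply: regret_product_le; rewrite ?ltW //; first by rewrite L0.
move=> l w legal; have c0 := interval_cost_ge0 Abase (ltW D0) legal 0 1 w.
apply: combined_cost_le_cst => //; first by rewrite L0.
move=> w'; rewrite /interval_cost add0n big_nat1 big_geq // mulr0 addr0.
have /andP[_ h] := legal 0%N (action A l 0 (w, w')).
by apply: (le_trans h); apply: (le_trans D_ge1); rewrite lerDr.
Qed.

End single_step_regret.

End main.

Theorem theorem3p3 (R : realType) :
  exists (C : R) (K : nat) (p : program), 0 < C /\
  forall (T L : nat) (D : R) (N : nat), T = (2 ^ L)%N -> 1 <= D ->
    (* at most K * (1 + log_2 T) computation steps per round *)
    (forall (tape : nat -> R) (fs : seq (feedback R L)),
        legal_tape tape -> (size fs < T)%N ->
        (forall t, (t < size fs)%N ->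
           legal_feedback (nth (fun=> (0, false)) fs t)) ->
        isSome (selection p (K * L.+1) T N D tape fs)) /\
    (forall (d : measure_display) (Omega : measurableType d)
        (P : probability Omega R)
        (Abase : algorithm R N T Omega)
        (A_ : 'I_L.+1 -> algorithm R N T Omega)
        (d' : measure_display) (Omega' : measurableType d')
        (Q : probability Omega' R) (U : nat -> Omega' -> R),
        uniform_source Q U ->
        exists A : algorithm R N T (Omega * Omega')%type,
          [/\ combined_by Abase A_ p (K * L.+1) D U A,
              forall (u : 'I_L.+1) (t0 k : nat),
                (t0 + k <= T)%N ->
                T%:R / 2 ^+ u.+1 <= k%:R :> R -> k%:R <= T%:R / 2 ^+ u :> R ->
                (regret D (P \x Q) A P (A_ u) t0 k
                   <= (C * D * Num.sqrt (k%:R * ln T%:R))%:E)%E &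
              (regret D (P \x Q) A P Abase 0 T <= D%:E)%E]).
Proof.
exists 256, 100%N, combine; split; first by rewrite ltr0n.
move=> T L D N -> D_ge1; split.
  by move=> tape fs _ _ _; rewrite selection_combine.
move=> d Omega P Abase A_ d' Omega' Q U HU.
exists (combined Abase A_ D HU); split; first exact: combined_by_combine.
  move=> u t0 k kT k_ge k_le; have [L0|L0] := posnP L; last first.
    exact: regret_challenger.
  have k0 : (0 < k)%N.
    by rewrite -(ltr0n R); apply: lt_le_trans k_ge;
       rewrite divr_gt0 ?exprn_gt0 // ltr0n expn_gt0.
  have -> : u = ord0.
    by apply: val_inj; have := ltn_ord u; rewrite /= [in X in (_ < X)%N]L0; lia.
  apply: le_trans (regret_challenger_single P Abase A_ HU D_ge1 L0 kT k0) _.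
  by rewrite lee_fin !mulr_ge0 ?sqrtr_ge0 // (le_trans ler01).
have [L0|L0] := posnP L; first exact: regret_base_single.
exact: regret_base.
Qed.
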